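(* Let $0\le k<n$, $W\in\mathrm{Gr}_{k+1,n}^{>0}$, and let $w^{(0)},w^{(1)},\dots,w^{(k)}$ be a basis of $W$ such that $V:=\mathrm{span}(w^{(1)},\dots,w^{(k)})\in\mathrm{Gr}_{k,n}^{>0}$ and $w^{(0)}$ is positively oriented with respect to $V$. Let $\mathcal{H}^W$, $\psi_{\mathcal{H}^W}$, $\Psi_{\mathcal{H}^W}$ and $B(\mathcal{H}^W)$ be as in the context. Then the restriction of $\Psi_{\mathcal{H}^W}$ to $B(\mathcal{H}^W)$ is a homeomorphism from $B(\mathcal{H}^W)$ onto $\mathcal{B}_{n,k,1}(W)$, and it induces an isomorphism of posets between the strata of $B(\mathcal{H}^W)$ (its bounded faces) and the strata of $\mathcal{B}_{n,k,1}(W)$ (each ordered by containment of closures). Explicitly, $\Psi_{\mathcal{H}^W}$ sends the face $\psi_{\mathcal{H}^W}^{-1}(\sigma)$ of $B(\mathcal{H}^W)$ onto $\mathcal{B}_\sigma(W)$ for every $\sigma\in\overline{\mathrm{Sign}_{n,k,1}}$.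
   Context: $\mathrm{Gr}_{k,n}$ is the real Grassmannian; $\mathrm{Gr}_{k,n}^{\ge0}$ (resp. $\mathrm{Gr}_{k,n}^{>0}$) consists of subspaces whose Plücker coordinates are all $\ge0$ (resp. all $>0$) for a suitable representative. For $v\in\mathbb{R}^n$, $\mathrm{var}(v)$ is the number of sign changes of $v_1,\dots,v_n$ ignoring zeros ($\mathrm{var}(0)=-1$), and $\overline{\mathrm{var}}(v)=\max\{\mathrm{var}(w): w_i=v_i \text{ whenever } v_i\neq0\}$; the same definitions apply to sign vectors in $\{0,+,-\}^n$, and $\mathrm{sign}(v)$ is the componentwise sign. Positive orientation: if $V\in\mathrm{Gr}_{k,n}^{>0}$ and $w\notin V$ with $V+\mathbb{R}w\in \mathrm{Gr}_{k+1,n}^{>0}$, let $U:=V^\perp\cap(V+\mathbb{R}w)$ (a line) and let $u\in U$ with $w-u\in V$. Then $u_1\neq0$; $w$ is called positively oriented with respect to $V$ if $u_1>0$. Hyperplane arrangement: $\mathcal{H}^W$ is the arrangement in $\mathbb{R}^k$ of the hyperplanes $H_i=\{x\in\mathbb{R}^k: w^{(1)}_ix_1+\cdots+w^{(k)}_ix_k+w^{(0)}_i=0\}$, $i\in[n]$. Define $\psi_{\mathcal{H}^W}(x):=\mathrm{sign}(x_1w^{(1)}+\cdots+x_kw^{(k)}+w^{(0)})\in\{0,+,-\}^n$ and $\Psi_{\mathcal{H}^W}(x):=\langle x_1w^{(1)}+\cdots+x_kw^{(k)}+w^{(0)}\rangle\in\mathbb{P}(W)$. The faces of $\mathcal{H}^W$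 are the nonempty fibers $\psi_{\mathcal{H}^W}^{-1}(\sigma)$ (the face labeled by $\sigma$). $B(\mathcal{H}^W)$ is the complex (union) of bounded faces. $\overline{\mathrm{Sign}_{n,k,1}}$ is the set of nonzero $\sigma\in\{0,+,-\}^n$ with $\overline{\mathrm{var}}(\sigma)=k$ such that, if $i$ is the index of the first nonzero component, then $\sigma_i=(-1)^{i-1}$. $\mathcal{B}_{n,k,1}(W):=\{V'^\perp\cap W: V'\in\mathrm{Gr}_{k,n}^{\ge0}\}\subseteq\mathbb{P}(W)$ (each $V'^\perp\cap W$ is a line); for nonzero $\sigma$ with $\overline{\mathrm{var}}(\sigma)=k$, its stratum is $\mathcal{B}_\sigma(W):=\{\langle w\rangle: w\in W\setminus\{0\},\ \mathrm{sign}(w)=\pm\sigma\}$. *)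

(* Defs.v *)
From HB Require Import structures.
From mathcomp Require Import all_boot all_order all_algebra.
From mathcomp Require Import all_classical all_reals all_analysis.
Set Implicit Arguments.
Unset Strict Implicit.
Unset Printing Implicit Defensive.
Import Order.TTheory GRing.Theory Num.Theory.
Import numFieldNormedType.Exports.
Local Open Scope classical_set_scope.
Local Open Scope ring_scope.

Inductive sgn : predArgType := Zero | Pos | Neg.

Definition sgn_code (s : sgn) : option bool :=
  match s with Zero => None | Pos => Some true | Neg => Some false end.
Definition sgn_decode (o : option bool) : sgn :=
  match o with None => Zero | Some true => Pos | Some false => Neg end.
Lemma sgn_codeK : cancel sgn_code sgn_decode. Proof. by case. Qed.
HB.instance Definition _ := Finite.copy sgn (can_type sgn_codeK).

Definition sgn_opp (s : sgn) : sgn :=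
  match s with Zero => Zero | Pos => Neg | Neg => Pos end.

Notation signvec n := {ffun 'I_n -> sgn}.

Definition signvec0 n : signvec n := [ffun=> Zero].
Definition signvec_opp n (s : signvec n) : signvec n :=
  [ffun i => sgn_opp (s i)].

Definition sgn_of (R : realType) (x : R) : sgn :=
  if x == 0 then Zero else if 0 < x then Pos else Neg.
Definition sign (R : realType) n (v : 'rV[R]_n) : signvec n :=
  [ffun i => sgn_of (v 0 i)].

Definition var n (s : signvec n) : int :=
  if [seq x <- [seq s i | i <- enum 'I_n] | x != Zero] is x :: t
  then (sumn (pairmap (fun y z => (y != z) : nat) x t))%:Z else -1.

(* The default value -1 of the maximum is a lower bound of var. *)
Definition ovar n (s : signvec n) : int :=
  \big[Order.max/(-1)]_(t : signvec n |
    [forall i, (s i != Zero) ==> (t i == s i)]) var t.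

(* With 0-based indices, (-1)^(i-1) for the i-th component is + iff i is
   even. *)
Definition Sign_bar n (k : nat) : set (signvec n) :=
  [set s | [/\ s <> signvec0 n, ovar s = k%:Z &
    forall i : 'I_n, s i != Zero ->
      (forall j : 'I_n, (j < i)%N -> s j = Zero) ->
      s i = if odd i then Neg else Pos]].

Section Grassmannian.
Variables (R : realType) (n : nat).
Implicit Types V W : {vspace 'rV[R]_n}.

Definition represents k (A : 'M[R]_(k, n)) V : Prop :=
  row_free A /\ V = <<[seq row i A | i : 'I_k]>>%VS.

(* The k-subsets of the columns are given by their increasing enumerations. *)
Definition Gr_nonneg k V : Prop :=
  exists2 A : 'M[R]_(k, n), represents A V &
    forall f : 'I_k -> 'I_n, {homo f : i j / (i < j)%N} ->
      0 <= \det (colsub f A).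

Definition Gr_pos k V : Prop :=
  exists2 A : 'M[R]_(k, n), represents A V &
    forall f : 'I_k -> 'I_n, {homo f : i j / (i < j)%N} ->
      0 < \det (colsub f A).

Definition dotv (u v : 'rV[R]_n) : R := \sum_i u 0 i * v 0 i.

Definition orthv V : {vspace 'rV[R]_n} :=
  lker (linfun (mulmxr (\matrix_(i < \dim V) (vbasis V)`_i)^T)).

Lemma orthvP V v :
  reflect (forall u, u \in V -> dotv u v = 0) (v \in orthv V).
Proof.
have dotE u : dotv u v = (v *m u^T) 0 0.
  by rewrite mxE; apply: eq_bigr => i _; rewrite mxE mulrC.
rewrite memv_ker lfunE /=; apply: (iffP eqP) => [v0 u uV|v0].
  rewrite dotE (coord_vbasis uV) linear_sum mulmx_sumr summxE big1// => i _.
  rewrite linearZ /= -scalemxAr mxE [X in _ * X](_ : _ = 0) ?mulr0//.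
  move/matrixP: v0 => /(_ 0 i); rewrite !mxE => v0i.
  by rewrite -[RHS]v0i; apply: eq_bigr => j _; rewrite !mxE.
apply/rowP => i; rewrite !mxE -[RHS](v0 (vbasis V)`_i).
  by apply: eq_bigr => j _; rewrite !mxE mulrC.
by apply: vbasis_mem; rewrite mem_nth// size_tuple.
Qed.

End Grassmannian.

(* u is the orthogonal projection of w to the orthogonal complement of V, so
   it exists and is unique. *)
Definition positively_oriented (R : realType) n (V : {vspace 'rV[R]_n.+1})
    (w : 'rV[R]_n.+1) : Prop :=
  exists u : 'rV[R]_n.+1,
    [/\ u \in (orthv V :&: (V + <[w]>))%VS, w - u \in V & 0 < u 0 ord0].

Definition projsp (R : realType) (n : nat) : Type :=
  {L : {vspace 'rV[R]_n.+1} | \dim L == 1%N}.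

Section ProjectiveSpace.
Variables (R : realType) (n : nat).
Local Notation P := (projsp R n).

HB.instance Definition _ := Choice.on P.

Definition cone (U : set P) : set 'rV[R]_n.+1 :=
  [set v | exists2 L : P, U L & val L = <[v]>%VS].

(* Quotient topology of v |-> <[v]> on the nonzero vectors; these form an open
   subset of the space of all vectors. *)
Definition proj_open : set_system P := [set U | open (cone U)].

Lemma dim_line (v : 'rV[R]_n.+1) : v != 0 -> \dim <[v]> == 1%N.
Proof. by rewrite dim_vline => ->. Qed.

Lemma cone_neq0 U v : cone U v -> v != 0.
Proof.
move=> [L _ Lv]; apply/eqP => v0; have := valP L.
by rewrite Lv v0 dim_vline eqxx.
Qed.

Lemma proj_openT : proj_open setT.
Proof.
rewrite /proj_open /= [X in open X](_ : _ = ~` [set 0]).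
  by apply: closed_openC; exact/accessible_closed_set1/hausdorff_accessible/
    norm_hausdorff.
apply/seteqP; split=> v /= => [/cone_neq0/eqP//|/eqP v0].
by exists (exist _ <[v]>%VS (dim_line v0)).
Qed.

Lemma proj_openI A B : proj_open A -> proj_open B -> proj_open (A `&` B).
Proof.
rewrite /proj_open /= => oA oB.
rewrite [X in open X](_ : _ = cone A `&` cone B); first exact: openI.
apply/seteqP; split=> v /=; first by move=> [L [AL BL] Lv]; split; exists L.
move=> [[L AL Lv] [L' BL L'v]]; exists L => //; split=> //.
by suff -> : L = L' by []; apply: val_inj; rewrite /= Lv L'v.
Qed.

Lemma proj_open_bigU (I : Type) (f : I -> set P) :
  (forall i, proj_open (f i)) -> proj_open (\bigcup_i f i).
Proof.
rewrite /proj_open /= => of_.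
rewrite [X in open X](_ : _ = \bigcup_i cone (f i)).
  by apply: bigcup_open => i _; exact: of_.
apply/seteqP; split=> v /=; first by move=> [L [i _ fL] Lv]; exists i => //; exists L.
by move=> [i _ [L fL Lv]]; exists L => //; exists i.
Qed.

HB.instance Definition _ :=
  isOpenTopological.Build P proj_openT proj_openI proj_open_bigU.

Lemma const1_neq0 : const_mx 1 != 0 :> 'rV[R]_n.+1.
Proof.
by apply/eqP => /rowP/(_ ord0)/eqP; rewrite !mxE (negbTE (oner_neq0 R)).
Qed.

(* <[v]> as a point of the projective space, with a junk value at v = 0. *)
Definition line (v : 'rV[R]_n.+1) : P :=
  insubd (exist _ <[const_mx 1]>%VS (dim_line const1_neq0) : P) <[v]>%VS.

Lemma val_line v : v != 0 -> val (line v) = <[v]>%VS.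
Proof. by move=> v0; rewrite /line val_insubd dim_line. Qed.

End ProjectiveSpace.

Section Arrangement.
Variables (R : realType) (n k : nat) (w : 'I_k.+1 -> 'rV[R]_n.+1).

(* The span of w^(1), ..., w^(k). *)
Definition dirspan : {vspace 'rV[R]_n.+1} :=
  <<[seq w (lift ord0 i) | i : 'I_k]>>%VS.

Definition affcomb (x : 'rV[R]_k) : 'rV[R]_n.+1 :=
  \sum_(i < k) x 0 i *: w (lift ord0 i) + w ord0.

Definition psi (x : 'rV[R]_k) : signvec n.+1 := sign (affcomb x).

Definition Psi (x : 'rV[R]_k) : projsp R n := line (affcomb x).

Definition face (s : signvec n.+1) : set 'rV[R]_k := psi @^-1` [set s].

Definition bounded_faces : set (set 'rV[R]_k) :=
  [set F | [/\ exists s, F = face s, F !=set0 & bounded_set F]].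

Definition bounded_complex : set 'rV[R]_k := \bigcup_(F in bounded_faces) F.

End Arrangement.

Section Amplituhedron.
Variables (R : realType) (n k : nat) (W : {vspace 'rV[R]_n.+1}).

Definition amplituhedron : set (projsp R n) :=
  [set L | exists2 V' : {vspace 'rV[R]_n.+1}, Gr_nonneg k V' &
    val L = (orthv V' :&: W)%VS].

Definition stratum (s : signvec n.+1) : set (projsp R n) :=
  [set L | exists v : 'rV[R]_n.+1,
    [/\ v \in W, v != 0, sign v = s \/ sign v = signvec_opp s
      & val L = <[v]>%VS]].

Definition strata : set (set (projsp R n)) :=
  [set S | exists s : signvec n.+1,
    [/\ s <> signvec0 n.+1, ovar s = k%:Z & S = stratum s]].

End Amplituhedron.

Definition homeomorphism_on (T U : topologicalType) (A : set T) (B : set U)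
    (f : T -> U) : Prop :=
  [/\ set_bij A B f, {within A, continuous f} &
    exists2 g : U -> T, {within B, continuous g} & {in A, cancel f g}].

(* f is an isomorphism between the families X and Y of sets, both ordered by
   containment of closures. *)
Definition closure_poset_iso (T U : topologicalType) (X : set (set T))
    (Y : set (set U)) (f : set T -> set U) : Prop :=
  set_bij X Y f /\
  forall F G, X F -> X G ->
    (closure F `<=` closure G <-> closure (f F) `<=` closure (f G)).

(* Main.v *)
Require Import Defs.
From HB Require Import structures.
From mathcomp Require Import all_boot all_order perm all_algebra.
From mathcomp Require Import all_classical all_reals all_analysis.
From mathcomp Require Import zify ring lra.
Set Implicit Arguments.
Unset Strict Implicit.
Unset Printing Implicit Defensive.
Import Order.TTheory GRing.Theory Num.Theory.
Import numFieldNormedType.Exports.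
Local Open Scope classical_set_scope.
Local Open Scope ring_scope.

(* For a sign vector s, search greedily for a longest subsequence that weakly
   alternates +, -, +, ... (or -, +, -, ...). The positions not selected carry
   exactly the opposite of the sign waited for, so the two lengths determine
   ovar s, differ by one when s is nonzero, and the larger one is read off the
   first nonzero sign.

   Gantmakher and Krein: if V is totally positive of dimension k, the sign
   vectors of V \ {0} are the nonzero s with ovar s < k. If V' is totally
   nonnegative of dimension k, the Cauchy-Binet formula shows that no nonzero
   vector of V is orthogonal to V'; as this persists when the coordinates of V
   are rescaled by positive factors, every nonzero vector orthogonal to V' has
   ovar >= k. Conversely, every z with ovar z >= k is orthogonal to some such V'.
   Hence the points of B_{n,k,1}(W) are the lines spanned by the z in W with
   ovar z = k; such z are not in V, so that they can be rescaled to lie in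
   w^(0) + V, the image of the arrangement.

   Let B be a positive matrix of V. Positive orientation says that the maximal
   minors of (z; B), which do not depend on z in w^(0) + V, are positive. When
   ovar z = k, expanding such a minor along a weakly alternating subsequence of
   length k + 1 shows that this subsequence starts with + (so that the sign of
   z is in Sign_bar) and bounds the entries of z in terms of sign z only: the
   face of z is bounded. When ovar z < k, some vector of V has the same sign as
   z and is a recession direction of the face. *)

(** * Weakly alternating subsequences *)

Section GreedyAlternation.
Local Open Scope nat_scope.
Implicit Types (b e : bool) (x y : sgn) (l t : seq sgn).

Definition sgn_bool b : sgn := if b then Neg else Pos.

Lemma sgn_eqE x y : (x == y) =
  match x, y with Zero, Zero | Pos, Pos | Neg, Neg => true | _, _ => false end.
Proof. by case: x; case: y. Qed.

Lemma sgn_bool_neq0 b : sgn_bool b != Zero.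
Proof. by case: b. Qed.

Lemma sgn_opp_bool b : sgn_opp (sgn_bool b) = sgn_bool (~~ b).
Proof. by case: b. Qed.

Lemma sgn_oppK : involutive sgn_opp.
Proof. by case. Qed.

(* The greedy search for a longest subsequence of l whose nonzero entries agree
   with (-1)^e, -(-1)^e, (-1)^e, ...: an entry is rejected exactly when it has
   the sign opposite to the one waited for. *)
Fixpoint alt_mask e l : bitseq :=
  if l is x :: l' then
    let sel := x != sgn_bool (~~ e) in sel :: alt_mask (e (+) sel) l'
  else [::].

Definition alt_size e l := count id (alt_mask e l).

Fixpoint strict_alt_size e l : nat :=
  if l is x :: l' then
    let sel := x == sgn_bool e in sel + strict_alt_size (e (+) sel) l'
  else 0.

Lemma alt_size_cons e x l : alt_size e (x :: l) =
  (x != sgn_bool (~~ e)) + alt_size (e (+) (x != sgn_bool (~~ e))) l.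
Proof. by []. Qed.

Lemma size_alt_mask e l : size (alt_mask e l) = size l.
Proof. by elim: l e => //= x l IH e; rewrite IH. Qed.

Lemma nth_alt_mask e l i (c := count id (take i (alt_mask e l))) : i < size l ->
  nth false (alt_mask e l) i = (nth Zero l i != sgn_bool (~~ (e (+) odd c))).
Proof.
rewrite /c {c}; elim: l e i => // x l IH e [|i] /= il; first by rewrite addbF.
by rewrite IH// oddD oddb addbA.
Qed.

Lemma alt_size_opp e l : alt_size e (map sgn_opp l) = alt_size (~~ e) l.
Proof.
elim: l e => // x l IH e; rewrite map_cons !alt_size_cons IH -addNb.
by rewrite (inv_eq sgn_oppK) sgn_opp_bool.
Qed.

Lemma alt_size_leS e l : alt_size e l <= (alt_size (~~ e) l).+1.
Proof.
elim: l e => // x l IH e; rewrite !alt_size_cons negbK.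
by have := IH e; have := IH (~~ e); rewrite negbK; case: x; case: e => /=; lia.
Qed.

(* Whether the first nonzero entry l_i of l is (-1)^(e + i). *)
Fixpoint leads e l : bool :=
  if l is x :: l' then if x == Zero then leads (~~ e) l' else x == sgn_bool e
  else false.

Lemma has_leads e l : has (fun x => x != Zero) l = leads e l || leads (~~ e) l.
Proof.
elim: l e => //= x l IH e.
by case: x => /=; [exact: IH|by case: e|by case: e].
Qed.

Lemma alt_size_leads e l : leads e l -> alt_size e l = (alt_size (~~ e) l).+1.
Proof.
elim: l e => //= x l IH e; rewrite !alt_size_cons negbK.
by have := IH (~~ e); case: x; case: e => //= IHe;
  [move/IHe->|move/IHe->|..]; lia.
Qed.

Lemma leads_opp e l : leads e (map sgn_opp l) = leads (~~ e) l.
Proof.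
elim: l e => //= x l IH e; rewrite IH.
by rewrite !(inv_eq sgn_oppK) sgn_opp_bool.
Qed.

Lemma leads_nth e l i : leads e l -> nth Zero l i != Zero ->
  (forall j, j < i -> nth Zero l j = Zero) ->
  nth Zero l i = sgn_bool (e (+) odd i).
Proof.
elim: l e i => //= x l IH e [|i] /= xl xi z.
  by move: xl; rewrite (negbTE xi) addbF => /eqP.
have x0 : x = Zero := z 0 isT; rewrite x0 eqxx in xl.
by rewrite (IH _ _ xl xi) ?addNb ?addbN// => j ji; apply: (z j.+1).
Qed.

Lemma strict_alt_size_filter e l :
  strict_alt_size e [seq x <- l | x != Zero] = strict_alt_size e l.
Proof.
elim: l e => //= x l IH e; case: eqVneq => [->|_] /=; rewrite IH//.
by rewrite eq_sym (negbTE (sgn_bool_neq0 _)) addbF.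
Qed.

Lemma strict_alt_size_pairmap e l : all (fun x => x != Zero) l ->
  strict_alt_size e l =
  sumn (pairmap (fun y z => (y != z) : nat) (sgn_bool (~~ e)) l).
Proof.
elim: l e => //= x l IH e /andP[x0 /IH ->].
by case: x x0 => // _; case: e.
Qed.

Definition refines l t := all2 (fun x y => (x == Zero) || (y == x)) l t.

Lemma strict_alt_size_refines e l t :
  refines l t -> strict_alt_size e t <= alt_size e l.
Proof.
elim: l e t => [|x l IH] e [|y t] //= /andP[xy /IH le]; rewrite alt_size_cons.
have := alt_size_leS e l; have := le e; have := le (~~ e).
by case: x xy; case: y => // _; rewrite !sgn_eqE; case: e => /=; lia.
Qed.

Fixpoint alt_fill e l : seq sgn :=
  if l is x :: l' then
    let sel := x != sgn_bool (~~ e) in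
    (if sel then sgn_bool e else x) :: alt_fill (e (+) sel) l'
  else [::].

Lemma size_alt_fill e l : size (alt_fill e l) = size l.
Proof. by elim: l e => //= x l IH e; rewrite IH. Qed.

Lemma refines_alt_fill e l : refines l (alt_fill e l).
Proof.
elim: l e => //= x l IH e; rewrite /refines /= -/(refines _ _) IH andbT.
by case: x; case: e.
Qed.

Lemma strict_alt_size_fill e l :
  strict_alt_size e (alt_fill e l) = alt_size e l.
Proof.
elim: l e => //= x l IH e; rewrite alt_size_cons -IH.
by case: x; case: e.
Qed.

End GreedyAlternation.

Section Variation.
Variable n : nat.
Implicit Types (s t : signvec n) (e : bool).

Definition alt_length e s := alt_size e (codom s).

Lemma nth_codom_signvec s (i : 'I_n) : nth Zero (codom s) i = s i.
Proof. by rewrite (nth_map i) ?size_enum_ord// nth_ord_enum. Qed.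

Lemma var_strict_alt_size s : var s + 1 =
  (maxn (strict_alt_size false (codom s)) (strict_alt_size true (codom s)))%:Z.
Proof.
rewrite /var -/(codom s) -![in RHS](strict_alt_size_filter _ (codom s)).
have := filter_all (fun x => x != Zero) (codom s).
case: [seq _ <- _ | _] => [//|x l] xl; rewrite !strict_alt_size_pairmap//=.
by case/andP: xl => x0 _; case: x x0 => //= _; lia.
Qed.

Lemma refines_codom s t :
  refines (codom s) (codom t) = [forall i, (s i != Zero) ==> (t i == s i)].
Proof.
rewrite /refines all2E !size_codom eqxx /= zip_map all_map.
apply/allP/forallP => [st i|st i _] /=; last by have := st i; case: (s i).
by have := st i (mem_enum _ i); rewrite /=; case: (s i).
Qed.

Lemma exists_alt_fill e s : exists t : signvec n,
  refines (codom s) (codom t) /\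
  strict_alt_size e (codom t) = alt_length e s.
Proof.
pose t : signvec n := [ffun i : 'I_n => nth Zero (alt_fill e (codom s)) i].
have tE : codom t = alt_fill e (codom s).
  apply: (@eq_from_nth _ Zero); first by rewrite size_alt_fill !size_codom.
  rewrite size_codom card_ord => i il.
  by rewrite -[i]/(val (Ordinal il)) nth_codom_signvec ffunE.
by exists t; rewrite tE refines_alt_fill strict_alt_size_fill.
Qed.

Lemma ovar_alt_length s :
  ovar s + 1 = (maxn (alt_length false s) (alt_length true s))%:Z.
Proof.
apply/eqP; rewrite eq_le -lerBrDr; apply/andP; split.
  apply/bigmax_leP; split=> [|t]; first lia.
  rewrite -refines_codom => st; have := var_strict_alt_size t.
  have := strict_alt_size_refines false st.
  by have := strict_alt_size_refines true st; rewrite -!/(alt_length _ _); lia.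
suff le_ovar e : (alt_length e s)%:Z <= ovar s + 1.
  by have := le_ovar false; have := le_ovar true; lia.
have [t [st <-]] := exists_alt_fill e s.
have : var t <= ovar s by apply: le_bigmax_cond; rewrite -refines_codom.
by have := var_strict_alt_size t; case: e; lia.
Qed.

Lemma ovar_ltP s k :
  reflect (forall e, (alt_length e s <= k)%N) (ovar s < k%:Z).
Proof.
have sE := ovar_alt_length s; apply: (iffP idP) => [sk e|sk].
  by case: e; lia.
by have := sk true; have := sk false; lia.
Qed.

Lemma signvec_neq0P s : reflect (exists i, s i != Zero) (s != signvec0 n).
Proof.
apply: (iffP idP) => [|[i]]; last by apply: contraNneq => ->; rewrite ffunE.
apply: contraNP => /forallNP s0; apply/eqP/ffunP => i; rewrite ffunE.
by apply/eqP/negPn/negP/s0.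
Qed.

Lemma signvec_neq0_leads e s :
  (s != signvec0 n) = leads e (codom s) || leads (~~ e) (codom s).
Proof.
rewrite -has_leads; apply/signvec_neq0P/hasP => [[i si]|[_ /codomP[i ->] si]].
  by exists (s i); rewrite ?codom_f.
by exists i.
Qed.

Lemma exists_leads s : s != signvec0 n -> exists e, leads e (codom s).
Proof.
by rewrite (signvec_neq0_leads false) => /orP[]; [exists false|exists true].
Qed.

Lemma ovar_leads s e : leads e (codom s) -> ovar s + 1 = (alt_length e s)%:Z.
Proof.
move=> /alt_size_leads; rewrite -!/(alt_length _ _).
by have := ovar_alt_length s; case: e => /=; lia.
Qed.

Lemma ovar_ge0 s : s != signvec0 n -> 0 <= ovar s.
Proof.
move=> /exists_leads[e se]; have := ovar_leads se; have := alt_size_leads se.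
by rewrite -!/(alt_length _ _); lia.
Qed.

Lemma ovar_ge_exists_alt_length s k :
  k%:Z <= ovar s -> exists e, (k < alt_length e s)%N.
Proof.
rewrite leNgt => sk; apply: contrapT => /forallNP le_k; case/negP: sk.
by apply/ovar_ltP => e; rewrite leqNgt; apply/negP/le_k.
Qed.

Lemma codom_signvec_opp s : codom (signvec_opp s) = map sgn_opp (codom s).
Proof. by rewrite -map_comp; apply: eq_map => i; rewrite ffunE. Qed.

Lemma signvec_oppK : involutive (@signvec_opp n).
Proof. by move=> s; apply/ffunP => i; rewrite !ffunE sgn_oppK. Qed.

Lemma ovar_opp s : ovar (signvec_opp s) = ovar s.
Proof.
apply: (addIr 1); rewrite !ovar_alt_length /alt_length codom_signvec_opp.
by rewrite !alt_size_opp maxnC.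
Qed.

Lemma leads_signvec e s (i : 'I_n) : leads e (codom s) -> s i != Zero ->
  (forall j : 'I_n, (j < i)%N -> s j = Zero) -> s i = sgn_bool (e (+) odd i).
Proof.
move=> se si zero_lt_i.
rewrite -nth_codom_signvec (leads_nth se) ?nth_codom_signvec// => j ji.
have jn := ltn_trans ji (ltn_ord i).
by rewrite -[j]/(val (Ordinal jn)) nth_codom_signvec zero_lt_i.
Qed.

Lemma Sign_barP k s : Sign_bar k s <-> leads false (codom s) /\ ovar s = k%:Z.
Proof.
split=> [[/eqP s0 sk s_first]|[se sk]]; last first.
  split=> // [/eqP|i]; last exact: (@leads_signvec false).
  by rewrite -[_ == _]negbK (signvec_neq0_leads false) se.
have [e se] := exists_leads s0; split=> //.
have /signvec_neq0P[i0 si0] := s0.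
case: (@arg_minnP _ i0 [pred i | s i != Zero] val si0) => /= i si i_min.
have zero_lt_i (j : 'I_n) : (j < i)%N -> s j = Zero.
  by move=> ji; apply/eqP; apply: contraTT ji => /i_min; rewrite -leqNgt.
have := s_first i si zero_lt_i; rewrite (leads_signvec se si zero_lt_i).
by case: e se => //; case: (odd i).
Qed.

Lemma Sign_bar_opp k s : Sign_bar k s -> ~ Sign_bar k (signvec_opp s).
Proof.
move=> /Sign_barP[/alt_size_leads sE _] /Sign_barP[].
by rewrite codom_signvec_opp leads_opp => /alt_size_leads; rewrite sE /=; lia.
Qed.

Lemma Sign_bar_or_opp k s : s != signvec0 n -> ovar s = k%:Z ->
  Sign_bar k s \/ Sign_bar k (signvec_opp s).
Proof.
move=> s0 sk; have [[] se] := exists_leads s0; [right|left];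
  apply/Sign_barP; split=> //; last by rewrite ovar_opp.
by rewrite codom_signvec_opp leads_opp.
Qed.

Lemma Sign_bar_alt_length k s : Sign_bar k s -> alt_length false s = k.+1.
Proof. by move=> /Sign_barP[/ovar_leads + sk]; rewrite sk; lia. Qed.

End Variation.

(** * Subsets of the columns *)

Section OrdinalSets.
Variable n : nat.
Implicit Types (S : {set 'I_n}) (i : nat).

Definition count_below S i := #|[set j in S | (j < i)%N]|.

Lemma leq_count_below S i j :
  (i <= j)%N -> (count_below S i <= count_below S j)%N.
Proof.
move=> ij; apply: subset_leq_card; apply/fintype.subsetP => a.
by rewrite !inE => /andP[-> ai]; apply: leq_trans ai ij.
Qed.

Lemma ltn_count_below S (a : 'I_n) i :
  a \in S -> (a < i)%N -> (count_below S a < count_below S i)%N.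
Proof.
move=> aS ai; apply: proper_card; apply/properP; split; last first.
  by exists a; rewrite !inE aS // ltnn.
apply/fintype.subsetP => b; rewrite !inE => /andP[-> ba].
exact: ltn_trans ba ai.
Qed.

Lemma count_below_le_card S i : (count_below S i <= #|S|)%N.
Proof.
apply: subset_leq_card; apply/fintype.subsetP => a.
by rewrite !inE => /andP[].
Qed.

Lemma count_below_mask (m : bitseq) i : size m = n ->
  count_below [set j : 'I_n | nth false m j] i = count id (take i m).
Proof.
move=> mn; rewrite /count_below -sum1_card -sum1_count (big_nth false).
rewrite size_take_min mn big_mkord.
rewrite (big_ord_widen_cond n (nth false (take i m)) (fun=> 1%N)) ?geq_minr//.
apply: eq_bigl => j; rewrite !inE leq_min ltn_ord andbT.
by case: ltnP => ji; rewrite ?andbF ?andbT// nth_take.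
Qed.

Definition increasing m (f : 'I_m -> 'I_n) := {homo f : i j / (i < j)%N}.

Lemma increasing_inj m (f : 'I_m -> 'I_n) : increasing f -> injective f.
Proof.
move=> finc i j ij; apply: val_inj.
by case: (ltngtP i j) => // /finc; rewrite ij ltnn.
Qed.

Lemma increasing_comp m p (f : 'I_m -> 'I_n) (g : 'I_p -> 'I_m) :
  increasing f -> {homo g : i j / (i < j)%N} -> increasing (f \o g).
Proof. by move=> finc ginc i j /ginc/finc. Qed.

Lemma increasing_lift m (f : 'I_m.+1 -> 'I_n) j :
  increasing f -> increasing (f \o lift j).
Proof.
move=> /increasing_comp; apply => a b /=; rewrite /bump.
by do 2 case: leqP; lia.
Qed.

Lemma increasing_enum_val S : increasing (@enum_val _ (mem S)).
Proof.
move=> i j ij; have x0 := enum_val i; rewrite !(enum_val_nth x0).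
have ltn_ord_trans : transitive (relpre (@nat_of_ord n) ltn).
  by move=> a b c; apply: ltn_trans.
apply: (sorted_ltn_nth ltn_ord_trans); rewrite ?inE -?cardE ?ltn_ord//.
rewrite /enum_mem -enumT; apply: (sorted_filter ltn_ord_trans).
by rewrite -sorted_map val_enum_ord iota_ltn_sorted.
Qed.

Lemma count_below_enum_val S (j : 'I_#|S|) : count_below S (enum_val j) = j.
Proof.
have -> : count_below S (enum_val j) =
    #|enum_val @: [set i : 'I_#|S| | (i < j)%N]%SET|.
  congr #|pred_of_set _|; apply/setP => a; apply/idP/imsetP; rewrite !inE.
    move=> /andP[aS]; rewrite -(enum_rankK_in aS aS) => aj.
    exists (enum_rank_in aS a); rewrite // inE.
    move: (enum_rank_in _ _) aj => i.
    by case: (ltngtP i j) => // [/increasing_enum_val/ltnW ji|/val_inj->];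
      rewrite ltnNge ?ji ?leqnn.
  by move=> [i]; rewrite inE => /increasing_enum_val ij ->; rewrite enum_valP.
rewrite card_imset; last exact: enum_val_inj.
rewrite -sum1_card; transitivity (\sum_(i < j) 1)%N; last first.
  by rewrite sum1_card card_ord.
rewrite (big_ord_widen _ (fun=> 1%N) (ltnW (ltn_ord j))).
by apply: eq_bigl => i; rewrite inE.
Qed.

Definition insert_at m (c : 'I_m.+1) (a : 'I_n) (h : 'I_m -> 'I_n) :
  'I_m.+1 -> 'I_n := fun j => oapp h a (unlift c j).

Lemma insert_at_id m c a (h : 'I_m -> 'I_n) : insert_at c a h c = a.
Proof. by rewrite /insert_at unlift_none. Qed.

Lemma insert_at_lift m c a (h : 'I_m -> 'I_n) j :
  insert_at c a h (lift c j) = h j.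
Proof. by rewrite /insert_at liftK. Qed.

Lemma increasing_insert_at m (c : 'I_m.+1) a (h : 'I_m -> 'I_n) :
  increasing h -> (forall j, h j != a) ->
  (forall j, (h j < a)%N = (j < c)%N) -> increasing (insert_at c a h).
Proof.
move=> hinc ha hc i j.
case: (unliftP c i) => [i'|] ->; case: (unliftP c j) => [j'|] ->;
  rewrite ?insert_at_id ?insert_at_lift ?ltnn//.
- by move=> ij; apply: hinc; move: ij; rewrite /= /bump; do 2 case: leqP; lia.
- by rewrite hc /= /bump; case: leqP; lia.
- have := hc j'; have := ha j'; rewrite -(inj_eq val_inj) /= /bump.
  by case: leqP; lia.
Qed.

Lemma ltn_enum_val S (a : 'I_n) (j : 'I_#|S|) : a \notin S ->
  (enum_val j < a)%N = (j < count_below S a)%N.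
Proof.
move=> aS; rewrite -[nat_of_ord j]count_below_enum_val; case: ltnP => ja.
  by rewrite ltn_count_below ?enum_valP.
by rewrite ltnNge leq_count_below.
Qed.

Lemma increasing_insert_at_enum_val S (a : 'I_n) : a \notin S ->
  increasing (insert_at (inord (count_below S a)) a (@enum_val _ (mem S))).
Proof.
move=> aS; apply: increasing_insert_at => [|j|j].
- exact: increasing_enum_val.
- by apply: contraNneq aS => <-; apply: enum_valP.
- by rewrite (ltn_enum_val _ aS) inordK// ltnS count_below_le_card.
Qed.

Lemma count_below_setU1 S (a : 'I_n) i :
  (i <= a)%N -> count_below (a |: S) i = count_below S i.
Proof.
move=> ia; apply: eq_card => b; rewrite !inE; case: eqP => //= ->.
by rewrite ltnNge ia andbF.
Qed.

End OrdinalSets.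

Lemma increasing_codom n m (f : 'I_m -> 'I_n) :
  increasing f <-> sorted ltn [seq val i | i <- codom f].
Proof.
rewrite -map_comp; split=> [finc|fsorted i j ij].
  rewrite sorted_map; apply: (@sub_sorted _ (relpre val ltn)) => [i j /finc//|].
  by rewrite -sorted_map val_enum_ord iota_ltn_sorted.
have val_f (a : 'I_m) : val (f a) = nth 0%N [seq val (f c) | c <- enum 'I_m] a.
  by rewrite (nth_map a) ?size_enum_ord// nth_ord_enum.
rewrite -[_ (f i)]/(val (f i)) -[_ (f j)]/(val (f j)) !val_f.
by apply: (sorted_ltn_nth ltn_trans); rewrite // inE size_map size_enum_ord.
Qed.

Lemma increasing_eq n m (f g : 'I_m -> 'I_n) :
  increasing f -> increasing g -> codom f =i codom g -> f =1 g.
Proof.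
move=> finc ginc fg i; have : codom f = codom g.
  apply/(inj_map val_inj)/(irr_sorted_eq ltn_trans ltnn).
  - exact/increasing_codom.
  - exact/increasing_codom.
  - exact: eq_mem_map.
by move=> /eq_in_map; apply; rewrite mem_enum.
Qed.

Lemma increasing_eq_lift m (h : 'I_m -> 'I_m.+1) :
  increasing h -> exists j : 'I_m.+1, h =1 lift j.
Proof.
move=> hinc; have /subsetPn[j _ jh] : ~~ ('I_m.+1 \subset codom h).
  apply/negP => /subset_leq_card.
  by rewrite card_ord (card_codom (increasing_inj hinc)) card_ord ltnn.
exists j; apply: increasing_eq => //; first exact: (increasing_lift (f := id)).
apply/subset_cardP.
  by rewrite !card_codom//; [exact: lift_inj|exact: increasing_inj].
apply/fintype.subsetP => _ /codomP[c ->]; case: (unliftP j (h c)) => [i ->|hc].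
  exact: codom_f.
by case/negP: jh; rewrite -hc codom_f.
Qed.

Lemma increasing_sort n m (f : 'I_m -> 'I_n) :
  injective f -> exists s : 'S_m, increasing (f \o s).
Proof.
move=> finj; pose leq_val : rel 'I_n := relpre val leq.
have /tuple_permP[s sortE] :
    perm_eq (sort leq_val (codom f)) [tuple f i | i < m].
  by rewrite perm_sort.
exists s; apply/increasing_codom.
have -> : codom (f \o s) = sort leq_val (codom f).
  by rewrite sortE; apply: eq_map => i /=; rewrite tnth_mktuple.
rewrite ltn_sorted_uniq_leq map_inj_uniq ?sort_uniq; last exact: val_inj.
rewrite map_inj_uniq ?enum_uniq//= sorted_map.
by apply: (@sort_sorted _ leq_val) => i j; apply: leq_total.
Qed.

Section Alternation.
Variable n : nat.
Implicit Types (s : signvec n) (J : {set 'I_n}) (e : bool).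

Definition weakly_alternates m e s (g : 'I_m -> 'I_n) :=
  forall j, s (g j) != sgn_bool (~~ (e (+) odd j)).

(* Off J, the signs alternate at every element of J and are constant between
   consecutive ones. *)
Definition alternates_off e J s :=
  forall i, i \notin J -> s i = sgn_bool (e (+) odd (count_below J i)).

Definition alt_set e s : {set 'I_n} :=
  [set i : 'I_n | nth false (alt_mask e (codom s)) i]%SET.

Lemma size_alt_mask_codom e s : size (alt_mask e (codom s)) = n.
Proof. by rewrite size_alt_mask size_codom card_ord. Qed.

Lemma card_alt_set e s : #|alt_set e s| = alt_length e s.
Proof.
rewrite /alt_length /alt_size -[alt_mask e _]take_size size_alt_mask_codom.
rewrite -(count_below_mask _ (size_alt_mask_codom e s)); apply: eq_card => i.
by rewrite !inE ltn_ord andbT.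
Qed.

Lemma mem_alt_set e s i : (i \in alt_set e s) =
  (s i != sgn_bool (~~ (e (+) odd (count_below (alt_set e s) i)))).
Proof.
rewrite (count_below_mask _ (size_alt_mask_codom e s)) inE nth_alt_mask.
  by rewrite nth_codom_signvec.
by rewrite size_codom card_ord.
Qed.

Lemma alt_length_subseq m e s : (m <= alt_length e s)%N ->
  exists2 g : 'I_m -> 'I_n, increasing g & weakly_alternates e s g.
Proof.
rewrite -card_alt_set => mS; exists (enum_val \o widen_ord mS).
  by apply: increasing_comp (@increasing_enum_val _ _) _.
move=> j; have := enum_valP (widen_ord mS j).
by rewrite mem_alt_set count_below_enum_val.
Qed.

Lemma alternates_off_alt_set e s : alternates_off (~~ e) (alt_set e s) s.
Proof. by move=> i; rewrite mem_alt_set negbK addNb => /eqP. Qed.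

Lemma alternates_off_extend m e J s :
  alternates_off e J s -> (#|J| <= m < n)%N ->
  exists2 J' : {set 'I_n}, #|J'| = m & alternates_off e J' s.
Proof.
move=> Js /andP[/subnKC <-]; elim: (m - #|J|)%N => [|d IH] dn.
  by exists J; rewrite ?addn0.
have [|J' J'd J's] := IH; first by apply: leq_ltn_trans dn; rewrite leq_add2l.
have /subsetPn[i0 _ i0J'] : ~~ ([set: 'I_n] \subset J')%SET.
  apply: contraTN dn => /subset_leq_card.
  by rewrite cardsT card_ord J'd addnS -leqNgt => /leqW.
case: (@arg_maxnP _ i0 [pred i | i \notin J'] val i0J') => /= i1 i1J' i1max.
exists (i1 |: J')%SET; first by rewrite cardsU1 i1J' J'd addnS.
move=> i; rewrite in_setU1 negb_or => /andP[_ iJ'].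
by rewrite count_below_setU1 ?J's//; apply: i1max.
Qed.

(* The greedy search that first waits for the sign opposite to that of the first
   nonzero entry selects at most k entries. *)
Lemma ovar_lt_alternates_off k s :
  (k < n)%N -> s != signvec0 n -> ovar s < k.+1%:Z ->
  exists e J, #|J| = k /\ alternates_off e J s.
Proof.
move=> kn /exists_leads[e se] /ovar_ltP sk.
have s_alt := @alternates_off_alt_set (~~ e) s.
have [|J Jk Js] := alternates_off_extend (m := k) s_alt.
  rewrite kn card_alt_set andbT -ltnS -(alt_size_leads se); exact: sk.
by exists (~~ ~~ e), J.
Qed.

End Alternation.

(** * Maximal minors and total positivity *)

Section MaximalMinors.
Variables (R : comNzRingType) (n : nat).

Lemma det_colsub_noninj k (A : 'M[R]_(k, n)) (f : 'I_k -> 'I_n) i j :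
  i != j -> f i = f j -> \det (colsub f A) = 0.
Proof.
move=> ij fij; rewrite -det_tr; apply: (determinant_alternate ij) => c.
by rewrite !mxE fij.
Qed.

Lemma det_colsub_perm k (A : 'M[R]_(k, n)) (f : 'I_k -> 'I_n) (s : 'S_k) :
  \det (colsub (f \o s) A) = (-1) ^+ s * \det (colsub f A).
Proof.
rewrite colsub_comp -col_permEsub col_permE det_mulmx det_perm.
by rewrite odd_permV mulrC.
Qed.

Lemma det_mulmx_sum k (A : 'M[R]_(k, n)) (B : 'M[R]_(n, k)) :
  \det (A *m B) =
  \sum_(f : {ffun 'I_k -> 'I_n}) (\prod_i A i (f i)) * \det (rowsub f B).
Proof.
transitivity (\sum_(f : {ffun 'I_k -> 'I_n}) \sum_(s : 'S_k)
    (-1) ^+ s * \prod_i (A i (f i) * B (f i) (s i))).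
  rewrite exchange_big; apply: eq_bigr => s _; rewrite -big_distrr /=.
  congr (_ * _); rewrite -(bigA_distr_bigA (fun i j => A i j * B j (s i))).
  by apply: eq_bigr => i _; rewrite mxE.
apply: eq_bigr => f _; rewrite big_distrr; apply: eq_bigr => s _ /=.
rewrite big_split mulrCA; congr (_ * (_ * _)).
by apply: eq_bigr => i _; rewrite mxE.
Qed.

(* Cauchy-Binet, summed over all maps rather than over the increasing ones:
   each k-subset of the columns is counted k! times. *)
Lemma cauchy_binet k (A B : 'M[R]_(k, n)) : \det (A *m B^T) *+ k`! =
  \sum_(f : {ffun 'I_k -> 'I_n}) \det (colsub f A) * \det (colsub f B).
Proof.
have det_perm_sum (s : 'S_k) : \det (A *m B^T) =
    \sum_(f : {ffun 'I_k -> 'I_n})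
      (-1) ^+ s * (\prod_i A i (f (s i))) * \det (colsub f B).
  pose precomp (t : 'S_k) (f : {ffun 'I_k -> 'I_n}) := [ffun i => f (t i)].
  rewrite det_mulmx_sum (reindex (precomp s)).
    apply: eq_bigr => f _; under eq_bigr do rewrite ffunE.
    rewrite -det_tr trmx_mxsub trmxK mxsub_ffunr -/(f \o s) det_colsub_perm.
    by rewrite mulrCA mulrA.
  exists (precomp s^-1%g) => f _; apply/ffunP => i; rewrite !ffunE.
    by rewrite permKV.
  by rewrite permK.
rewrite -card_Sn -sumr_const; under eq_bigr => s _ do rewrite (det_perm_sum s).
rewrite exchange_big; apply: eq_bigr => f _ /=; rewrite -big_distrl /=.
congr (_ * _); apply: eq_bigr => s _; congr (_ * _); apply: eq_bigr => i _.
by rewrite mxE.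
Qed.

Definition bordered_minor k (v : 'rV[R]_n) (A : 'M[R]_(k, n))
    (g : 'I_k.+1 -> 'I_n) : R := \det (colsub g (col_mx v A) : 'M[R]_(1 + k)).

Lemma bordered_minorE k v (A : 'M[R]_(k, n)) (g : 'I_k.+1 -> 'I_n) :
  bordered_minor v A g =
  \sum_(j < k.+1) (-1) ^+ j * v 0 (g j) * \det (colsub (g \o lift j) A).
Proof.
rewrite [LHS](expand_det_row _ ord0); apply: eq_bigr => j _.
rewrite /cofactor add0n mxE mulrA [_ * (-1) ^+ j]mulrC.
congr (_ * _); last congr (\det _).
  have -> : ord0 = lshift k ord0 :> 'I_(1 + k) by apply: val_inj.
  by rewrite col_mxEu.
apply/matrixP => a b; rewrite !mxE.
have -> : lift ord0 a = rshift 1 a :> 'I_(1 + k) by apply: val_inj.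
by rewrite (unsplitK (inr a)).
Qed.

Lemma bordered_minor_addr k v (y : 'rV[R]_k) (A : 'M[R]_(k, n)) g :
  bordered_minor (v + y *m A) A g = bordered_minor v A g.
Proof.
rewrite /bordered_minor.
have -> : col_mx (v + y *m A) A = block_mx 1%:M y 0 1%:M *m col_mx v A.
  by rewrite mul_block_col !mul1mx mul0mx add0r.
by rewrite -mulmx_colsub det_mulmx det_ublock !det1 !mul1r.
Qed.

Lemma bordered_minor_mul k (y : 'rV[R]_k) (A : 'M[R]_(k, n)) g :
  bordered_minor (y *m A) A g = 0.
Proof.
rewrite -[y *m A]add0r bordered_minor_addr bordered_minorE big1// => j _.
by rewrite mxE mulr0 mul0r.
Qed.

(* The linear combination of the rows of C given by minor_row h C has, up to
   sign, the maximal minors containing the columns h as coordinates. *)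
Definition minor_row k (h : 'I_k -> 'I_n) (C : 'M[R]_(k.+1, n)) : 'rV[R]_k.+1 :=
  \row_i ((-1) ^+ i * \det (row' i (colsub h C))).

Lemma mul_minor_row k (h : 'I_k -> 'I_n) (C : 'M[R]_(k.+1, n)) (c : 'I_k.+1) a :
  (minor_row h C *m C) 0 a = (-1) ^+ c * \det (colsub (insert_at c a h) C).
Proof.
rewrite (expand_det_col _ c) mxE mulr_sumr; apply: eq_bigr => i _.
rewrite !mxE insert_at_id /cofactor exprD.
have -> : row' i (col' c (colsub (insert_at c a h) C)) = row' i (colsub h C).
  by apply/matrixP => p q; rewrite !mxE insert_at_lift.
rewrite [_ ^+ i * _ ^+ c]mulrC -!mulrA [C i a * _]mulrCA signrMK.
by rewrite [RHS]mulrC mulrA.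
Qed.

Lemma mul_minor_row_eq0 k (h : 'I_k -> 'I_n) (C : 'M[R]_(k.+1, n)) j :
  (minor_row h C *m C) 0 (h j) = 0.
Proof.
rewrite (mul_minor_row _ _ ord0).
rewrite (@det_colsub_noninj _ _ _ ord0 (lift ord0 j)) ?mulr0//.
by rewrite insert_at_id insert_at_lift.
Qed.

Definition cofactor_row k (M : 'M[R]_(k, k.+1)) : 'rV[R]_k.+1 :=
  \row_j ((-1) ^+ j * \det (colsub (lift j) M)).

(* The matrix whose column g j is the column j of M and whose other columns
   vanish. *)
Definition scatter_cols k m (g : 'I_m -> 'I_n) (M : 'M[R]_(k, m)) :
  'M[R]_(k, n) := M *m rowsub g 1%:M.

Lemma mul_scatter_cols k m (g : 'I_m -> 'I_n) (M : 'M[R]_(k, m))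
    (v : 'rV[R]_n) :
  scatter_cols g M *m v^T = M *m (colsub g v)^T.
Proof. by rewrite -mulmxA mul_rowsub_mx mul1mx trmx_mxsub. Qed.

Lemma colsub_scatter_cols k m p (g : 'I_m -> 'I_n) (M : 'M[R]_(k, m))
    (h : 'I_p -> 'I_m) :
  injective g -> colsub (g \o h) (scatter_cols g M) = colsub h M.
Proof.
move=> ginj; rewrite -mulmx_colsub -[M in RHS]mulmx1 -mulmx_colsub.
by congr (_ *m _); apply/matrixP => i j; rewrite !mxE (inj_eq ginj).
Qed.

End MaximalMinors.

Lemma mul_cofactor_row (R : comNzRingType) k (M : 'M[R]_(k, k.+1)) :
  M *m (cofactor_row M)^T = 0.
Proof.
apply/row_matrixP => i; rewrite row_mul row0; apply/rowP => c.
have := bordered_minor_mul (delta_mx 0 i) M id; rewrite -rowE bordered_minorE.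
move=> sum0; rewrite mxE [RHS]mxE -[RHS]sum0; apply: eq_bigr => j _.
by rewrite (ord1 c) !mxE mulrCA mulrA.
Qed.

Section HyperplaneMatrix.
Variables (F : fieldType) (k : nat) (y : 'rV[F]_k.+1) (j0 : 'I_k.+1).
Hypothesis yj0 : y 0 j0 != 0.

Definition hyperplane_mx : 'M[F]_(k, k.+1) :=
  \matrix_(i, c) if unlift j0 c is Some i' then (i == i')%:R
                 else - (y 0 (lift j0 i) / y 0 j0).

Lemma mul_hyperplane_mx (q : 'rV[F]_k.+1) i :
  (hyperplane_mx *m q^T) i 0 =
  q 0 (lift j0 i) - y 0 (lift j0 i) / y 0 j0 * q 0 j0.
Proof.
rewrite mxE (bigD1_ord j0)//= !mxE unlift_none addrC mulNr; congr (_ - _).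
rewrite (bigD1 i)//= !mxE liftK eqxx mul1r big1 ?addr0// => i' ii'.
by rewrite mxE liftK eq_sym (negbTE ii') mul0r.
Qed.

Lemma hyperplane_mx_orthogonal : hyperplane_mx *m y^T = 0.
Proof.
apply/matrixP => i c; rewrite (ord1 c) mul_hyperplane_mx mxE.
by rewrite divfK// subrr.
Qed.

Lemma colsub_lift_hyperplane_mx : colsub (lift j0) hyperplane_mx = 1%:M.
Proof. by apply/matrixP => i j; rewrite !mxE liftK. Qed.

Lemma row_free_hyperplane_mx : row_free hyperplane_mx.
Proof.
by apply/row_freeP; exists (colsub (lift j0) 1%:M);
  rewrite mulmx_colsub mulmx1 colsub_lift_hyperplane_mx.
Qed.

(* The row of signed minors is orthogonal to the hyperplane too, hence
   proportional to y. *)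
Lemma det_colsub_lift_hyperplane_mx j :
  \det (colsub (lift j) hyperplane_mx) =
  ((-1) ^+ j * y 0 j) / ((-1) ^+ j0 * y 0 j0).
Proof.
set q := cofactor_row hyperplane_mx.
have minorE i : \det (colsub (lift i) hyperplane_mx) = (-1) ^+ i * q 0 i.
  by rewrite mxE signrMK.
have q_prop : q 0 j = y 0 j / y 0 j0 * q 0 j0.
  case: (unliftP j0 j) => [i ->|->]; last by rewrite divff ?mul1r.
  by apply/eqP; rewrite -subr_eq0 -mul_hyperplane_mx mul_cofactor_row mxE.
have q_j0 : q 0 j0 = (-1) ^+ j0.
  by rewrite mxE colsub_lift_hyperplane_mx det1 mulr1.
by rewrite minorE q_prop q_j0 invr_signM; ring.
Qed.

End HyperplaneMatrix.

Lemma row_free_scatter_cols (F : fieldType) n k m (g : 'I_m -> 'I_n)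
    (M : 'M[F]_(k, m)) :
  injective g -> row_free M -> row_free (scatter_cols g M).
Proof.
move=> ginj Mfree; apply: inj_row_free => y yM; apply: (row_free_inj Mfree).
rewrite mul0mx -[M]mxsub_id -(colsub_scatter_cols M id ginj).
by rewrite mulmx_colsub yM mxsub_const.
Qed.

Section TotalPositivity.
Variables (R : realFieldType) (n : nat).

Definition TNN k (A : 'M[R]_(k, n)) :=
  forall f : 'I_k -> 'I_n, increasing f -> 0 <= \det (colsub f A).

Definition TP k (A : 'M[R]_(k, n)) :=
  forall f : 'I_k -> 'I_n, increasing f -> 0 < \det (colsub f A).

Lemma TP_TNN k (A : 'M[R]_(k, n)) : TP A -> TNN A.
Proof. by move=> tpA f /tpA/ltW. Qed.

Lemma TP_minor_neq0 k (A : 'M[R]_(k, n)) (f : 'I_k -> 'I_n) :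
  TP A -> injective f -> \det (colsub f A) != 0.
Proof.
move=> tpA /increasing_sort[s fs]; have := tpA _ fs; rewrite det_colsub_perm.
by apply: contraTneq => ->; rewrite mulr0 ltxx.
Qed.

Lemma TP_colsub_unitmx k (A : 'M[R]_(k, n)) (f : 'I_k -> 'I_n) :
  TP A -> increasing f -> colsub f A \in unitmx.
Proof. by move=> tpA finc; rewrite unitmxE unitfE gt_eqF// tpA. Qed.

Lemma TNN_minor_mul_ge0 k (A B : 'M[R]_(k, n)) (f : 'I_k -> 'I_n) :
  TNN A -> TNN B -> 0 <= \det (colsub f A) * \det (colsub f B).
Proof.
move=> nnA nnB; have [/injectiveP|/injectivePn[i [j ij fij]]] :=
  boolP (injectiveb f); last by rewrite (det_colsub_noninj _ ij fij) mul0r.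
move=> /increasing_sort[s fs]; have := mulr_ge0 (nnA _ fs) (nnB _ fs).
by rewrite !det_colsub_perm mulrACA -signr_addb addbb mul1r.
Qed.

Lemma TNN_det_mulmx_tr_ge0 k (A B : 'M[R]_(k, n)) :
  TNN A -> TNN B -> 0 <= \det (A *m B^T).
Proof.
move=> nnA nnB; rewrite -(pmulrn_lge0 _ (fact_gt0 k)) cauchy_binet.
by apply: sumr_ge0 => f _; apply: TNN_minor_mul_ge0.
Qed.

Lemma TNN_TP_det_mulmx_tr_gt0 k (A B : 'M[R]_(k, n)) :
  row_free A -> TNN A -> TP B -> 0 < \det (A *m B^T).
Proof.
move=> Afree nnA tpB; have ge0 g : 0 <= \det (colsub g A) * \det (colsub g B).
  by apply: TNN_minor_mul_ge0 => //; apply: TP_TNN.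
have Afull : row_full A^T by rewrite /row_full mxrank_tr.
pose f := fullrankfun Afull.
have fA : \det (colsub f A) != 0.
  rewrite -unitfE -unitmxE -unitmx_tr trmx_mxsub -row_full_unit.
  exact: fullrowsub_full.
rewrite -(pmulrn_lgt0 _ (fact_gt0 k)) cauchy_binet (bigD1 f)//=.
rewrite ltr_pwDl ?sumr_ge0// lt_def ge0 andbT mulf_neq0// TP_minor_neq0//.
exact: fullrankfun_inj.
Qed.

Lemma TP_mul_diag k (A : 'M[R]_(k, n)) (d : 'rV[R]_n) :
  TP A -> (forall i, 0 < d 0 i) -> TP (A *m diag_mx d).
Proof.
move=> tpA d0 f finc.
have -> : colsub f (A *m diag_mx d) = colsub f A *m diag_mx (colsub f d).
  by rewrite !mul_mx_diag; apply/matrixP => i j; rewrite !mxE.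
rewrite det_mulmx det_diag mulr_gt0 ?tpA//.
by apply: prodr_gt0 => i _; rewrite mxE.
Qed.

Lemma TP_colsub_inj k (A : 'M[R]_(k, n)) (f : 'I_k -> 'I_n) (y : 'rV[R]_k) :
  TP A -> increasing f -> (forall j, (y *m A) 0 (f j) = 0) -> y = 0.
Proof.
move=> tpA finc yf; apply: (can_inj (mulmxK (TP_colsub_unitmx tpA finc))).
by rewrite mul0mx mulmx_colsub; apply/rowP => j; rewrite mxE yf mxE.
Qed.

Lemma TP_interpolation k (A : 'M[R]_(k, n)) (f : 'I_k -> 'I_n) (r : 'I_n -> R) :
  TP A -> increasing f ->
  exists y : 'rV[R]_k, forall j, (y *m A) 0 (f j) = r (f j).
Proof.
move=> tpA finc; exists ((\row_j r (f j)) *m invmx (colsub f A)) => j.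
have /rowP/(_ j) := mulmxKV (TP_colsub_unitmx tpA finc) (\row_j r (f j)).
by rewrite mulmx_colsub !mxE.
Qed.

Definition alternates_along m (e : bool) (v : 'rV[R]_n) (g : 'I_m -> 'I_n) :=
  forall j : 'I_m, 0 <= (-1) ^+ (e + j) * v 0 (g j).

Lemma alternates_along_bordered_minor k (A : 'M[R]_(k, n)) v e
    (g : 'I_k.+1 -> 'I_n) :
  alternates_along e v g ->
  (-1) ^+ e * bordered_minor v A g =
  \sum_(j < k.+1) `|v 0 (g j)| * \det (colsub (g \o lift j) A).
Proof.
move=> alt; rewrite bordered_minorE mulr_sumr; apply: eq_bigr => j _.
rewrite !mulrA -exprD -(ger0_norm (alt j)).
by rewrite normrM normrX normrN1 expr1n mul1r.
Qed.

Lemma alternates_along_bordered_minor_ge k (A : 'M[R]_(k, n)) v e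
    (g : 'I_k.+1 -> 'I_n) j0 :
  TNN A -> increasing g -> alternates_along e v g ->
  `|v 0 (g j0)| * \det (colsub (g \o lift j0) A) <=
  (-1) ^+ e * bordered_minor v A g.
Proof.
move=> nnA ginc /alternates_along_bordered_minor->.
rewrite (bigD1 j0)//= lerDl sumr_ge0// => j _.
by rewrite mulr_ge0// nnA//; apply: increasing_lift.
Qed.

Lemma TNN_scatter_cols k m (g : 'I_m -> 'I_n) (M : 'M[R]_(k, m)) :
  increasing g ->
  (forall h : 'I_k -> 'I_m, increasing h -> 0 <= \det (colsub h M)) ->
  TNN (scatter_cols g M).
Proof.
move=> ginc nnM f finc; have [/forallP fg|/forallPn[c /codomP fc]] :=
  boolP [forall c, f c \in codom g].
  have /choice[h fE] c : exists j, f c = g j by apply/codomP.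
  have hinc : increasing h.
    move=> a b ab; have := finc _ _ ab; rewrite !fE.
    by case: (ltngtP (h a) (h b)) => // [/ginc/ltnW|/val_inj->]; lia.
  rewrite (@eq_colsub _ _ _ _ f (g \o h))// colsub_scatter_cols ?nnM//.
  exact: increasing_inj.
rewrite -det_tr (expand_det_row _ c) big1// => i _.
rewrite !mxE big1 ?mul0r// => j _; rewrite !mxE.
have [gj|_] := eqVneq (g j) (f c); last by rewrite mulr0.
by case: fc; exists j.
Qed.

End TotalPositivity.

Section ExistsTNNOrthogonal.
Variables (R : realFieldType) (n k : nat).

Lemma TNN_hyperplane_mx (y : 'rV[R]_k.+1) j0 :
  y 0 j0 != 0 -> alternates_along false y id -> TNN (hyperplane_mx y j0).
Proof.
move=> yj0 alt h /increasing_eq_lift[j hj].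
rewrite (@eq_colsub _ _ _ _ _ (lift j))//.
by rewrite det_colsub_lift_hyperplane_mx// divr_ge0//; apply: alt.
Qed.

Lemma alternates_along_scale_neq0 (v : 'rV[R]_n) e (g : 'I_k.+1 -> 'I_n) :
  alternates_along e v g ->
  exists y : 'rV[R]_k.+1, exists2 j0, y 0 j0 != 0 &
    alternates_along false y id /\ exists c, colsub g v = c *: y.
Proof.
move=> alt; have [v0|/rV0Pn[j0 vj0]] := eqVneq (colsub g v) 0.
  exists (\row_(j < k.+1) (-1) ^+ j), ord0; first by rewrite mxE oner_eq0.
  split=> [j|]; first by rewrite mxE -expr2 sqrr_sign.
  by exists 0; rewrite scale0r.
exists ((-1) ^+ e *: colsub g v), j0.
  by rewrite mxE mulf_neq0// signr_eq0.
split=> [j|]; first by rewrite !mxE mulrA -exprD addnC alt.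
by exists ((-1) ^+ e); rewrite scalerA -expr2 sqrr_sign scale1r.
Qed.

Lemma exists_TNN_orthogonal (v : 'rV[R]_n) e (g : 'I_k.+1 -> 'I_n) :
  increasing g -> alternates_along e v g ->
  exists A : 'M[R]_(k, n), [/\ row_free A, TNN A & A *m v^T = 0].
Proof.
move=> ginc /alternates_along_scale_neq0[y [j0 yj0 [yalt [c vE]]]].
exists (scatter_cols g (hyperplane_mx y j0)); split.
- exact/row_free_scatter_cols/row_free_hyperplane_mx/increasing_inj.
- exact/TNN_scatter_cols/TNN_hyperplane_mx.
- rewrite mul_scatter_cols vE linearZ -scalemxAr.
  by rewrite hyperplane_mx_orthogonal ?scaler0.
Qed.

End ExistsTNNOrthogonal.

Section OrientedExtension.
Variables (R : realFieldType) (n k : nat).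
Implicit Types (B : 'M[R]_(k, n.+1)) (u v : 'rV[R]_n.+1).

Let e0 : 'rV[R]_n.+1 := delta_mx 0 ord0.

Lemma TNN_col_mx_delta B : TNN B -> TNN (col_mx e0 B).
Proof.
move=> nnB g ginc; rewrite -/(bordered_minor _ _ _) bordered_minorE.
apply: sumr_ge0 => j _; rewrite mxE eqxx /=.
have [gj0|_] := eqVneq (g j) ord0; last by rewrite mulr0 mul0r.
have -> : j = ord0.
  apply/val_inj/eqP; rewrite -leqn0 leqNgt; apply/negP => j0.
  by have := ginc ord0 j j0; rewrite gj0.
by rewrite expr0 mulr1 mul1r nnB//; apply: increasing_lift.
Qed.

Lemma det_col_mx_orthogonal B u : B *m u^T = 0 ->
  \det (col_mx u B *m (col_mx e0 B)^T) = u 0 ord0 * \det (B *m B^T).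
Proof.
move=> Bu; have uB : u *m B^T = 0.
  by rewrite -[LHS]trmxK trmx_mul trmxK Bu trmx0.
rewrite tr_col_mx mul_col_row uB det_lblock; congr (_ * _).
by rewrite trmx_delta -colE det_mx11 mxE.
Qed.

(* The maximal minors of [v; B] and A are proportional. The sign of the factor
   is found by pairing, with Cauchy-Binet, the minors with those of [e0; B]. *)
Lemma TP_col_mx_oriented (A : 'M[R]_(k.+1, n.+1)) B v u :
  TP A -> row_free B -> TP B -> (col_mx v B <= A)%MS ->
  (v - u <= B)%MS -> B *m u^T = 0 -> 0 < u 0 ord0 -> TP (col_mx v B).
Proof.
move=> tpA Bfree tpB /submxP[P vBE] /submxP[y vuE] Bu u_gt0.
have nnB := TP_TNN tpB; pose X := col_mx e0 B.
suff P_gt0 : 0 < \det P.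
  move=> f finc; rewrite vBE -mulmx_colsub det_mulmx mulr_gt0 ?P_gt0//.
  exact: tpA.
have detPAX : 0 < \det P * \det (A *m X^T).
  rewrite -det_mulmx mulmxA -vBE.
  have -> : col_mx v B = block_mx 1%:M y 0 1%:M *m col_mx u B.
    by rewrite mul_block_col !mul1mx mul0mx add0r -vuE subrKC.
  rewrite -mulmxA det_mulmx det_ublock !det1 !mul1r det_col_mx_orthogonal//.
  by rewrite mulr_gt0// TNN_TP_det_mulmx_tr_gt0.
have AX_ge0 : 0 <= \det (A *m X^T).
  by apply: TNN_det_mulmx_tr_ge0; [exact: TP_TNN|exact: TNN_col_mx_delta].
have AX_gt0 : 0 < \det (A *m X^T).
  rewrite lt_def AX_ge0 andbT.
  by apply: contraTneq detPAX => ->; rewrite mulr0 ltxx.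
by rewrite pmulr_lgt0 in detPAX.
Qed.

End OrientedExtension.

(** * The theorem of Gantmakher and Krein *)

Section SignOfReal.
Variable R : realType.
Implicit Types (x y c : R) (e : bool).

Lemma sgn_of_eq0 x : (sgn_of x == Zero) = (x == 0).
Proof. by rewrite /sgn_of; case: (ltgtP x 0). Qed.

Lemma sgn_of_eq_bool e x : (sgn_of x == sgn_bool e) = (0 < (-1) ^+ e * x).
Proof.
rewrite /sgn_of; case: e; rewrite ?expr1 ?expr0 ?mulN1r ?mul1r ?oppr_gt0;
by case: (ltgtP x 0).
Qed.

Lemma sgn_of_neq_bool e x :
  (sgn_of x != sgn_bool (~~ e)) = (0 <= (-1) ^+ e * x).
Proof. by rewrite sgn_of_eq_bool signrN mulNr oppr_gt0 leNgt. Qed.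

Lemma sgn_ofM c x : 0 < c -> sgn_of (c * x) = sgn_of x.
Proof. by move=> c0; rewrite /sgn_of mulf_eq0 gt_eqF//= pmulr_rgt0. Qed.

Lemma sgn_ofN x : sgn_of (- x) = sgn_opp (sgn_of x).
Proof. by rewrite /sgn_of oppr_eq0 oppr_gt0; case: (ltgtP x 0). Qed.

Lemma sgn_of_neq0 x : x != 0 -> sgn_of x = sgn_bool (x < 0).
Proof. by rewrite /sgn_of; case: (ltgtP x 0). Qed.

Lemma sgn_ofD x y : sgn_of y = sgn_of x -> sgn_of (x + y) = sgn_of x.
Proof.
have [->|x0 yx] := eqVneq x 0; first by rewrite add0r.
have /eqP xE := sgn_of_neq0 x0; rewrite (eqP xE) in yx *.
move: xE (introT eqP yx); rewrite !sgn_of_eq_bool => x_gt0 y_gt0.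
by apply/eqP; rewrite sgn_of_eq_bool mulrDr addr_gt0.
Qed.

Lemma sgn_of_addl_small x y : `|y| < `|x| -> sgn_of (x + y) = sgn_of x.
Proof.
move=> yx; have x0 : x != 0 by rewrite -normr_gt0; apply: le_lt_trans yx.
have /eqP xE := sgn_of_neq0 x0; rewrite (eqP xE); move: xE.
set e := (x < 0); rewrite sgn_of_eq_bool => x_gt0; apply/eqP.
rewrite sgn_of_eq_bool mulrDr -ltrBlDr sub0r.
rewrite -[_ * x]gtr0_norm// normrMsign.
by apply: le_lt_trans yx; rewrite -[leRHS](normrMsign e) -normrN ler_norm.
Qed.

Definition sgn_val (a : sgn) : R :=
  match a with Zero => 0 | Pos => 1 | Neg => -1 end.

Lemma sgn_valK : cancel sgn_val (@sgn_of R).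
Proof.
case; rewrite /sgn_of /= ?eqxx ?oner_eq0 ?ltr01//.
by rewrite oppr_eq0 oner_eq0 oppr_gt0 ltr10.
Qed.

End SignOfReal.

Section SignVector.
Variables (R : realType) (n : nat).
Implicit Types (u v : 'rV[R]_n).

Lemma sign_eq0 v : (sign v == signvec0 n) = (v == 0).
Proof.
apply/eqP/eqP => [/ffunP v0|->]; last first.
  by apply/ffunP => i; rewrite !ffunE mxE /sgn_of eqxx.
apply/rowP => i; have /eqP := v0 i.
by rewrite !ffunE mxE sgn_of_eq0 => /eqP.
Qed.

Lemma weakly_alternates_sign m e v (g : 'I_m -> 'I_n) :
  weakly_alternates e (sign v) g <-> alternates_along e v g.
Proof.
have altE j : (sign v (g j) != sgn_bool (~~ (e (+) odd j))) =
    (0 <= (-1) ^+ (e + j) * v 0 (g j)).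
  by rewrite ffunE sgn_of_neq_bool signr_addb signr_odd -exprD.
by split=> alt j; have := alt j; rewrite altE.
Qed.

Lemma sign_perturb u v : exists2 c : R, 0 < c &
  forall i, u 0 i != 0 -> sgn_of (u 0 i + c * v 0 i) = sgn_of (u 0 i).
Proof.
pose S := 1 + \sum_i `|v 0 i| / `|u 0 i|.
have S_gt0 : 0 < S by rewrite ltr_pwDl// sumr_ge0.
exists S^-1; rewrite ?invr_gt0// => i ui; apply: sgn_of_addl_small.
rewrite normrM gtr0_norm ?invr_gt0// ltr_pdivrMl// -ltr_pdivrMr ?normr_gt0//.
by rewrite /S (bigD1 i)//= addrCA ltrDl ltr_pwDl// sumr_ge0.
Qed.

Lemma sign_scale (c : R) v : c != 0 ->
  sign (c *: v) = sign v \/ sign (c *: v) = signvec_opp (sign v).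
Proof.
case: (ltgtP c 0) => // c0 _; [right|left]; apply/ffunP => i;
  rewrite !ffunE mxE.
  by rewrite -[c]opprK mulNr sgn_ofN sgn_ofM// oppr_gt0.
by rewrite sgn_ofM.
Qed.

Lemma ovar_sign_scale (c : R) v :
  c != 0 -> ovar (sign (c *: v)) = ovar (sign v).
Proof. by move=> /(sign_scale v)[->|->]; rewrite ?ovar_opp. Qed.

Lemma sign_eq_rescale u v : sign u = sign v ->
  exists2 d : 'rV[R]_n, forall i, 0 < d 0 i & v = u *m diag_mx d.
Proof.
move=> uv; have sgnE i : sgn_of (u 0 i) = sgn_of (v 0 i).
  by have /ffunP/(_ i) := uv; rewrite !ffunE.
exists (\row_i (if v 0 i == 0 then 1 else v 0 i / u 0 i)) => [i|].
  rewrite mxE; case: eqVneq => // vi.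
  have /eqP := sgn_of_neq0 vi; have /eqP := sgnE i; rewrite {1}(sgn_of_neq0 vi).
  rewrite !sgn_of_eq_bool; move: (v 0 i < 0) => e u_gt0 v_gt0.
  by rewrite -[_ / _]mul1r -(divff (negbT (signr_eq0 _ e))) mulf_div divr_gt0.
apply/rowP => i; rewrite mul_mx_diag !mxE; have [vi|vi] := eqVneq (v 0 i) 0.
  by rewrite mulr1 vi; apply/esym/eqP; rewrite -sgn_of_eq0 sgnE vi sgn_of_eq0.
by rewrite mulrCA divff ?mulr1// -sgn_of_eq0 sgnE sgn_of_eq0.
Qed.

End SignVector.

Section GantmakherKrein.
Variables (R : realType) (n : nat).
Implicit Types (u v : 'rV[R]_n) (s : signvec n) (J : {set 'I_n}).

(* A weakly alternating subsequence of length k + 1 makes all the terms in the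
   expansion of a vanishing determinant vanish. *)
Lemma TP_ovar_lt k (A : 'M[R]_(k, n)) (y : 'rV[R]_k) :
  TP A -> y != 0 -> ovar (sign (y *m A)) < k%:Z.
Proof.
move=> tpA y0; apply/ovar_ltP => e.
apply: contraNleq y0 => /alt_length_subseq[g ginc].
move=> /weakly_alternates_sign alt; apply/eqP.
apply: (TP_colsub_inj tpA (increasing_lift ord0 ginc)) => j /=.
have := alternates_along_bordered_minor_ge (lift ord0 j) (TP_TNN tpA) ginc alt.
rewrite bordered_minor_mul mulr0 pmulr_lle0 ?normr_le0 => [/eqP//|].
exact/tpA/increasing_lift.
Qed.

Section RealizeAlternatesOff.
Variables (J : {set 'I_n}) (B : 'M[R]_(#|J|.+1, n)).
Hypotheses (J_proper : (#|J| < n)%N) (tpB : TP B).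

Let minor_vec := minor_row (@enum_val _ (mem J)) B *m B.

Lemma minor_vec_eq0 i : i \in J -> minor_vec 0 i = 0.
Proof.
by move=> iJ; rewrite -[i](enum_rankK_in iJ iJ); apply: mul_minor_row_eq0.
Qed.

Lemma minor_vec_sign i :
  i \notin J -> 0 < (-1) ^+ count_below J i * minor_vec 0 i.
Proof.
move=> iJ; rewrite /minor_vec (mul_minor_row _ _ (inord (count_below J i))).
rewrite inordK ?ltnS ?count_below_le_card// signrMK.
exact/tpB/increasing_insert_at_enum_val.
Qed.

Lemma TP_interpolation_set (r : 'I_n -> R) :
  exists y : 'rV[R]_#|J|.+1, forall i, i \in J -> (y *m B) 0 i = r i.
Proof.
have /subsetPn[a _ aJ] : ~~ ('I_n \subset J).
  by apply: contraTN J_proper => /subset_leq_card; rewrite card_ord leqNgt.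
have [y yr] := TP_interpolation r tpB (increasing_insert_at_enum_val aJ).
exists y => i iJ.
have := yr (lift (inord (count_below J a)) (enum_rank_in iJ i)).
by rewrite insert_at_lift enum_rankK_in.
Qed.

(* The vector of maximal minors vanishes on J and has the required signs off J;
   a small multiple of an interpolating vector corrects the signs on J. *)
Lemma TP_realize_alternates_off e s :
  alternates_off e J s -> exists y : 'rV[R]_#|J|.+1, sign (y *m B) = s.
Proof.
move=> sJ; have [y yJ] := TP_interpolation_set (fun i => sgn_val R (s i)).
have [c c_gt0 cE] := sign_perturb ((-1) ^+ e *: minor_vec) (y *m B).
exists ((-1) ^+ e *: minor_row (@enum_val _ (mem J)) B + c *: y).
apply/ffunP => i; rewrite ffunE mulmxDl -!scalemxAl -/minor_vec.
rewrite mxE [X in _ + X]mxE; have [iJ|iJ] := boolP (i \in J).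
  by rewrite mxE minor_vec_eq0// mulr0 add0r sgn_ofM// yJ// sgn_valK.
have minor_gt0 := minor_vec_sign iJ; rewrite cE; last first.
  rewrite mxE mulf_neq0 ?signr_eq0//.
  by apply: contraTneq minor_gt0 => ->; rewrite mulr0 ltxx.
apply/eqP; rewrite sJ// sgn_of_eq_bool signr_addb signr_odd mxE.
by rewrite mulrCA mulrA signrMK.
Qed.

End RealizeAlternatesOff.

Lemma TP_sign_realize k (B : 'M[R]_(k, n)) s : TP B -> (k <= n)%N ->
  s != signvec0 n -> ovar s < k%:Z -> exists y : 'rV[R]_k, sign (y *m B) = s.
Proof.
case: k B => [|k] B tpB kn s0 sk.
  by have := ovar_ge0 s0; rewrite leNgt sk.
have [e [J [Jk sJ]]] := ovar_lt_alternates_off kn s0 sk.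
by subst k; apply: TP_realize_alternates_off sJ.
Qed.

(* If ovar (sign u) < k, then some rescaling of the columns of B turns u into a
   combination of its rows, on which the pairing with A is nondegenerate. *)
Lemma TNN_orthogonal_ovar k (A B : 'M[R]_(k, n)) u : TP B -> (k <= n)%N ->
  row_free A -> TNN A -> u != 0 -> A *m u^T = 0 -> k%:Z <= ovar (sign u).
Proof.
move=> tpB kn Afree nnA u0 Au; rewrite leNgt; apply/negP => uk.
have [|y yu] := TP_sign_realize tpB kn _ uk; first by rewrite sign_eq0.
have [d d_gt0 uE] := sign_eq_rescale yu; rewrite -mulmxA in uE.
have /lt0r_neq0 := TNN_TP_det_mulmx_tr_gt0 Afree nnA (TP_mul_diag tpB d_gt0).
rewrite -unitfE -unitmxE => AB_unit.
have y0 : y^T = 0.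
  by apply: (can_inj (mulKmx AB_unit)); rewrite mulmx0 -mulmxA -trmx_mul -uE Au.
by case/eqP: u0; rewrite uE -[y]trmxK y0 trmx0 mul0mx.
Qed.

End GantmakherKrein.

Section GrassmannianSigns.
Variables (R : realType) (n : nat).
Implicit Types (v u : 'rV[R]_n) (V : {vspace 'rV[R]_n}) (s : signvec n).

Lemma span_rowsP m (X : 'I_m -> 'rV[R]_n) v :
  (v \in <<[seq X i | i : 'I_m]>>%VS) = (v <= \matrix_i X i)%MS.
Proof.
have spanE y : y *m (\matrix_i X i) = \sum_i y 0 i *: X i.
  by rewrite mulmx_sum_row; apply: eq_bigr => i _; rewrite rowK.
apply/idP/submxP => [vX|[y ->]].
  have XE : [seq X i | i : 'I_m] = [tuple X i | i < m] by [].
  rewrite XE in vX; exists (\row_i coord [tuple X i | i < m] i v).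
  rewrite spanE {1}(coord_span vX); apply: eq_bigr => i _.
  by rewrite mxE -tnth_nth tnth_mktuple.
rewrite spanE memv_suml// => i _; rewrite memvZ// memv_span//.
by apply/mapP; exists i; rewrite ?mem_enum.
Qed.

Lemma represents_mem k (A : 'M[R]_(k, n)) V v :
  represents A V -> (v \in V) = (v <= A)%MS.
Proof.
move=> [_ ->]; rewrite span_rowsP.
by have -> : \matrix_i row i A = A by apply/row_matrixP => i; rewrite rowK.
Qed.

Lemma represents_orthv k (A : 'M[R]_(k, n)) V v :
  represents A V -> v \in orthv V <-> A *m v^T = 0.
Proof.
move=> AV; have dotE u : dotv u v = (u *m v^T) 0 0.
  by rewrite mxE; apply: eq_bigr => i _; rewrite mxE.
split=> [/orthvP vV|Av].
  apply/row_matrixP => i; rewrite row_mul row0; apply/rowP => j.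
  by rewrite (ord1 j) -dotE mxE vV// (represents_mem _ AV) row_sub.
apply/orthvP => u; rewrite (represents_mem _ AV) => /submxP[y ->].
by rewrite dotE -mulmxA Av mulmx0 mxE.
Qed.

Lemma row_free_leq_cols k (A : 'M[R]_(k, n)) : row_free A -> (k <= n)%N.
Proof. by move=> /eqP <-; apply: rank_leq_col. Qed.

Lemma Gr_pos_ovar_lt k V v :
  Gr_pos k V -> v \in V -> v != 0 -> ovar (sign v) < k%:Z.
Proof.
move=> [A AV tpA]; rewrite (represents_mem _ AV) => /submxP[y ->] yA0.
by apply: TP_ovar_lt => //; apply: contraNneq yA0 => ->; rewrite mul0mx.
Qed.

Lemma Gr_pos_sign_realize k V s :
  Gr_pos k V -> s != signvec0 n -> ovar s < k%:Z ->
  exists2 v, v \in V & sign v = s.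
Proof.
move=> [A AV tpA] s0 sk; have kn := row_free_leq_cols AV.1.
have [y yA] := TP_sign_realize tpA kn s0 sk; exists (y *m A) => //.
by rewrite (represents_mem _ AV) submxMl.
Qed.

Lemma Gr_nonneg_orthv_ovar_ge k V V' u : Gr_pos k V -> Gr_nonneg k V' ->
  u \in orthv V' -> u != 0 -> k%:Z <= ovar (sign u).
Proof.
move=> [B BV tpB] [A AV' nnA] /(represents_orthv _ AV') Au u0.
exact: TNN_orthogonal_ovar tpB (row_free_leq_cols BV.1) AV'.1 nnA u0 Au.
Qed.

Lemma exists_Gr_nonneg_orthv k v : k%:Z <= ovar (sign v) ->
  exists2 V', Gr_nonneg k V' & v \in orthv V'.
Proof.
move=> /ovar_ge_exists_alt_length[e /alt_length_subseq[g ginc]].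
move=> /weakly_alternates_sign alt.
have [A [Afree nnA Av]] := exists_TNN_orthogonal ginc alt.
have AV' : represents A <<[seq row i A | i : 'I_k]>>%VS by [].
exists <<[seq row i A | i : 'I_k]>>%VS; first by exists A.
exact/(represents_orthv _ AV').
Qed.

End GrassmannianSigns.

(** * Topology of matrices and lines *)

Section MatrixNorm.
Variable R : realFieldType.

Lemma le_mx_norm m n (M : 'M[R]_(m, n)) i j : `|M i j| <= `|M|.
Proof.
rewrite [leRHS]/Num.norm /= mx_normrE.
exact: (le_bigmax _ (fun ij => `|M ij.1 ij.2|) (i, j)).
Qed.

Lemma mx_norm_le m n (M : 'M[R]_(m, n)) (c : R) : 0 <= c ->
  (forall i j, `|M i j| <= c) -> `|M| <= c.
Proof.
move=> c0 Mc; rewrite [leLHS]/Num.norm /= mx_normrE; apply/bigmax_leP.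
by split=> // -[i j] _; exact: Mc.
Qed.

Lemma mx_norm_mulmx m n p (M : 'M[R]_(m, n)) (N : 'M[R]_(n, p)) :
  `|M *m N| <= n%:R * (`|M| * `|N|).
Proof.
apply: mx_norm_le => [|i j]; first by rewrite !mulr_ge0.
rewrite mxE; apply: le_trans (ler_norm_sum _ _ _) _.
have -> : n%:R * (`|M| * `|N|) = \sum_(l < n) `|M| * `|N|.
  by rewrite sumr_const card_ord mulr_natl.
apply: ler_sum => l _.
by rewrite normrM ler_pM// le_mx_norm.
Qed.

Lemma mulmxr_continuous m n p (N : 'M[R]_(n, p)) :
  continuous (fun M : 'M[R]_(m, n) => M *m N).
Proof.
apply: (@bounded_linear_continuous _ _ _ (mulmxr N)); apply/bounded_funP => r.
exists (n%:R * (r * `|N|)) => M Mr.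
by apply: le_trans (mx_norm_mulmx _ _) _; rewrite ler_wpM2l// ler_wpM2r.
Qed.

End MatrixNorm.

Lemma ray_unbounded (R : realFieldType) (E : normedModType R) (A : set E)
    (x d : E) : d != 0 -> (forall t, 0 < t -> A (x + t *: d)) ->
  ~ bounded_set A.
Proof.
move=> d0 ray [M [_ /(_ (`|M| + 1))]].
rewrite ltr_pwDr ?ler_norm// => /(_ isT) le_M.
have d_gt0 : 0 < `|d| by rewrite normr_gt0.
pose t := (`|M| + 1 + `|x| + 1) / `|d|.
have t_gt0 : 0 < t by rewrite divr_gt0// ltr_wpDl// !addr_ge0.
have := le_M _ (ray _ t_gt0); rewrite /= => xtd_le.
have : `|t *: d| <= `|x + t *: d| + `|x|.
  by rewrite -{1}[t *: d](addKr x) addrC; apply: le_trans (ler_normB _ _) _.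
rewrite normrZ (gtr0_norm t_gt0) divfK ?gt_eqF//; lra.
Qed.

Lemma closure_subset_closure (T : topologicalType) (F G : set T) :
  closure F `<=` closure G <-> F `<=` closure G.
Proof.
split=> [FG x Fx|FG]; first exact/FG/subset_closure.
by have /closure_id -> := @closed_closure _ G; exact: closure_subset.
Qed.

Lemma closure_image (T U : topologicalType) (f : T -> U) (G : set T) x :
  {for x, continuous f} -> closure G x -> closure (f @` G) (f x).
Proof. by move=> fx Gx B /fx /Gx[y [Gy By]]; exists (f y); split. Qed.

Lemma image_cancel (T U : Type) (f : T -> U) (g : U -> T) :
  cancel f g -> cancel (fun F : set T => f @` F) (fun G : set U => g @` G).
Proof.
by move=> fK F; rewrite image_comp (_ : g \o f = id) ?image_id//; apply/funext.
Qed.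

Lemma closure_subset_image (T U : topologicalType) (f : T -> U) (g : U -> T)
    (F G : set T) : cancel f g -> continuous f ->
  (forall x, {for f x, continuous g}) ->
  closure F `<=` closure G <-> closure (f @` F) `<=` closure (f @` G).
Proof.
move=> fK fcont gcont; rewrite !closure_subset_closure.
split=> [FG _ [x Fx <-]|FG x Fx].
  exact: closure_image (fcont x) (FG _ Fx).
rewrite -(image_cancel fK G) -(fK x); apply: closure_image (gcont x) _.
by apply: FG; exists x.
Qed.

Section Lines.
Variables (R : realType) (n : nat).
Implicit Types (v u : 'rV[R]_n.+1) (L : projsp R n).

Lemma vline_scale (c : R) v : c != 0 -> <[c *: v]>%VS = <[v]>%VS.
Proof.
move=> c0; apply/eqP; rewrite eqEsubv -!memvE memvZ ?memv_line//=.
by apply/vlineP; exists c^-1; rewrite scalerA mulVf// scale1r.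
Qed.

Lemma line_scale (c : R) v : c != 0 -> line (c *: v) = line v.
Proof. by move=> c0; rewrite /line vline_scale. Qed.

Lemma val_eq_line L v : val L = <[v]>%VS -> L = line v.
Proof. by move=> Lv; rewrite /line -Lv valKd. Qed.

Lemma vpick_projsp_neq0 L : vpick (val L) != 0.
Proof. by rewrite vpick0 -dimv_eq0 (eqP (valP L)). Qed.

Lemma line_vpick L : line (vpick (val L)) = L.
Proof.
apply/esym/val_eq_line/eqP; rewrite eq_sym eqEdim -memvE memv_pick /=.
by rewrite (eqP (valP L)) dim_vline vpick_projsp_neq0.
Qed.

Lemma line_eq u v : u != 0 -> v != 0 -> line u = line v ->
  exists2 c : R, c != 0 & u = c *: v.
Proof.
move=> u0 v0 uv; have : u \in <[v]>%VS.
  by rewrite -val_line// -uv val_line// memv_line.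
move=> /vlineP[c uE]; exists c => //.
by apply: contraNneq u0 => c0; rewrite uE c0 scale0r.
Qed.

Lemma coneE (U : set (projsp R n)) v : cone U v <-> v != 0 /\ U (line v).
Proof.
split=> [Uv|[v0 Uv]]; last by exists (line v); rewrite ?val_line.
split; first exact: cone_neq0 Uv.
by case: Uv => L UL /val_eq_line <-.
Qed.

Lemma open_neq0 : open [set v : 'rV[R]_n.+1 | v != 0].
Proof.
have -> : [set v : 'rV[R]_n.+1 | v != 0] = cone setT; last exact: proj_openT.
by apply/seteqP; split=> v; rewrite coneE => -[].
Qed.

Lemma line_continuous v : v != 0 -> {for v, continuous (@line R n)}.
Proof.
move=> v0 A; rewrite nbhsE => -[U [oU Uv] UA].
have : nbhs v (cone U) by apply: open_nbhs_nbhs; split; [exact: oU|exact/coneE].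
by apply: filterS => u /coneE[_ /UA].
Qed.

Lemma nbhs_line v (A : set 'rV[R]_n.+1) :
  v != 0 -> nbhs v A -> nbhs (line v) (@line R n @` A).
Proof.
move=> v0; rewrite nbhsE => -[B [oB Bv] BA].
pose B' : set 'rV[R]_n.+1 := B `&` [set u | u != 0].
apply: (@filterS _ _ _ (@line R n @` B')).
  by move=> _ [u [Bu _] <-]; exists u => //; exact: BA.
apply: open_nbhs_nbhs; split; last by exists v.
suff : open (cone (@line R n @` B')) by [].
have -> : cone (@line R n @` B') =
    \bigcup_(c in [set c : R | c != 0]) ((fun u => c *: u) @^-1` B').
  apply/seteqP; split=> u.
    move=> /coneE[u0 [u' [Bu' u'0]]] /line_eq[]// c c0 u'E.
    by exists c => //=; rewrite -u'E.
  move=> [c /= c0 [Bcu cu0]]; apply/coneE; split.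
    by apply: contraNneq cu0 => ->; rewrite scaler0.
  by exists (c *: u); rewrite ?line_scale.
apply: bigcup_open => c _; apply: open_comp => [u _|].
  exact: scaler_continuous.
by apply: openI => //; exact: open_neq0.
Qed.

Section ScaleInvariant.
Variables (T : topologicalType) (f : 'rV[R]_n.+1 -> T).
Hypothesis f_scale : forall (c : R) v, c != 0 -> f (c *: v) = f v.

Lemma scale_invariant_vpick v : v != 0 -> f (vpick (val (line v))) = f v.
Proof.
move=> v0; have [|c c0 ->] := line_eq (vpick_projsp_neq0 (line v)) v0.
  exact: line_vpick.
exact: f_scale.
Qed.

Lemma scale_invariant_continuous v : v != 0 -> {for v, continuous f} ->
  {for line v, continuous (fun L => f (vpick (val L)))}.
Proof.
move=> v0 fv Q; rewrite scale_invariant_vpick// => /fv fQ.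
have nbhs_fQ : nbhs v ((f @^-1` Q) `&` [set u | u != 0]).
  by apply: filterI => //; apply: open_nbhs_nbhs; split=> //; exact: open_neq0.
suff : nbhs (line v) ((fun L => f (vpick (val L))) @^-1` Q) by [].
apply: filterS (nbhs_line v0 nbhs_fQ) => _ [u [Qu u0] <-] /=.
by rewrite scale_invariant_vpick.
Qed.

End ScaleInvariant.

End Lines.

(** * The arrangement *)

Section Arrangement.
Variables (R : realType) (n k : nat) (W : {vspace 'rV[R]_n.+1}).
Variable w : 'I_k.+1 -> 'rV[R]_n.+1.
Hypotheses (hW : Gr_pos k.+1 W) (hw : basis_of W (codom w)).
Hypotheses (hV : Gr_pos k (dirspan w)).
Hypothesis (hw0 : positively_oriented (dirspan w) (w ord0)).
Local Notation V := (dirspan w).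
Implicit Types (x : 'rV[R]_k) (v : 'rV[R]_n.+1) (s : signvec n.+1).

Definition dirmx : 'M[R]_(k, n.+1) := \matrix_i w (lift ord0 i).

Definition basismx : 'M[R]_(1 + k, n.+1) := col_mx (w ord0) dirmx.

Lemma affcombE x : affcomb w x = w ord0 + x *m dirmx.
Proof.
rewrite addrC /affcomb mulmx_sum_row; congr (_ + _).
by apply: eq_bigr => i _; rewrite rowK.
Qed.

Lemma affcomb_basismx x : affcomb w x = row_mx 1%:M x *m basismx.
Proof. by rewrite mul_row_col mul1mx affcombE. Qed.

Lemma basismxE : basismx = \matrix_i w i.
Proof.
apply/matrixP => i j; case: (fintype.split_ordP i) => a ->;
  rewrite ?col_mxEu ?col_mxEd !mxE.
  by rewrite (ord1 a); congr (w _ _ _); apply: val_inj.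
by congr (w _ _ _); apply: val_inj.
Qed.

Lemma mem_dirspan v : (v \in V) = (v <= dirmx)%MS.
Proof. exact: span_rowsP. Qed.

Lemma mem_basismx v : (v \in W) = (v <= basismx)%MS.
Proof. by rewrite -(span_basis hw) basismxE; apply: span_rowsP. Qed.

Lemma basismx_free : row_free basismx.
Proof.
rewrite basismxE; apply: inj_row_free => y y0; apply/rowP => i; rewrite mxE.
have /freeP w_free : free [tuple w i | i < k.+1] := basis_free hw.
apply: (w_free (fun i => y 0 i)); rewrite -[RHS]y0 mulmx_sum_row.
by apply: eq_bigr => j _; rewrite rowK -tnth_nth tnth_mktuple.
Qed.

Lemma dirspan_subv v : v \in V -> v \in W.
Proof.
rewrite mem_dirspan mem_basismx => /submx_trans; apply.
by rewrite -addsmxE addsmxSr.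
Qed.

Lemma affcomb_mem x : affcomb w x \in W.
Proof. by rewrite mem_basismx affcomb_basismx submxMl. Qed.

Lemma affcomb_neq0 x : affcomb w x != 0.
Proof.
rewrite affcomb_basismx -(mul0mx _ basismx).
rewrite (inj_eq (row_free_inj basismx_free)).
apply/eqP => /(congr1 lsubmx); rewrite row_mxKl => /rowP/(_ ord0)/eqP.
by rewrite !mxE oner_eq0.
Qed.

Lemma w_ord0_mem : w ord0 \in W.
Proof. by rewrite -[w ord0]addr0 -(mul0mx _ dirmx) -affcombE affcomb_mem. Qed.

Lemma exists_sub_affcomb_dirspan x v :
  v \in W -> exists c : R, v - c *: affcomb w x \in V.
Proof.
rewrite mem_basismx => /submxP[y ->]; exists (lsubmx y 0 0).
rewrite -[y in y *m _]hsubmxK mul_row_col [lsubmx y in X in X + _]mx11_scalar.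
rewrite mul_scalar_mx affcombE scalerDr opprD addrACA subrr add0r.
by rewrite mem_dirspan scalemxAl -mulmxBl submxMl.
Qed.

Lemma notin_dirspan_scale_affcomb v : v \in W -> v \notin V ->
  exists c x, c != 0 /\ v = c *: affcomb w x.
Proof.
move=> /(exists_sub_affcomb_dirspan 0)[c cV] vV; have c0 : c != 0.
  by apply: contraNneq vV => c0; move: cV; rewrite c0 scale0r subr0.
move: cV; rewrite mem_dirspan affcombE mul0mx addr0 => /submxP[y vE].
exists c, (c^-1 *: y); split=> //.
rewrite affcombE scalerDr -scalemxAl scalerA divff// scale1r -vE.
by rewrite addrC subrK.
Qed.

Lemma ovar_eq_scale_affcomb v : v \in W -> v != 0 -> ovar (sign v) = k%:Z ->
  exists c x, c != 0 /\ v = c *: affcomb w x.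
Proof.
move=> vW v0 vk; apply: notin_dirspan_scale_affcomb => //.
apply: contra_eqN vk => /(Gr_pos_ovar_lt hV)/(_ v0).
by rewrite lt_neqAle => /andP[].
Qed.

Lemma psi_neq0 x : psi w x != signvec0 n.+1.
Proof. by rewrite sign_eq0 affcomb_neq0. Qed.

Lemma bordered_minor_affcomb (B : 'M[R]_(k, n.+1)) g x : represents B V ->
  bordered_minor (affcomb w x) B g = bordered_minor (w ord0) B g.
Proof.
move=> BV; have /submxP[y yE] : (x *m dirmx <= B)%MS.
  by rewrite -(represents_mem _ BV) mem_dirspan submxMl.
by rewrite affcombE yE bordered_minor_addr.
Qed.

Lemma TP_col_mx_affcomb (B : 'M[R]_(k, n.+1)) x :
  represents B V -> TP B -> TP (col_mx (affcomb w x) B).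
Proof.
move=> BV tpB; have [A AW tpA] := hW.
have [u [/memv_capP[uV _] w0u u_gt0]] := hw0.
suff tp0 : TP (col_mx (w ord0) B).
  move=> g ginc; rewrite -/(bordered_minor _ _ _).
  by rewrite (bordered_minor_affcomb _ _ BV); apply: tp0.
apply: (@TP_col_mx_oriented _ _ _ A B (w ord0) u tpA BV.1 tpB) => //.
- rewrite col_mx_sub -(represents_mem _ AW) w_ord0_mem /=; apply/row_subP => i.
  rewrite -(represents_mem _ AW) dirspan_subv//.
  by rewrite (represents_mem _ BV) row_sub.
- by rewrite -(represents_mem _ BV).
- exact/(represents_orthv _ BV).
Qed.

Lemma psi_Sign_bar x : ovar (psi w x) = k%:Z -> Sign_bar k (psi w x).
Proof.
move=> xk; apply/Sign_barP; split=> //.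
have [e xe] := exists_leads (psi_neq0 x).
have := ovar_leads xe; rewrite xk => ek.
have /alt_length_subseq[g ginc /weakly_alternates_sign alt] :
  (k.+1 <= alt_length e (psi w x))%N by lia.
have [B BV tpB] := hV.
have minor_gt0 : 0 < bordered_minor (affcomb w x) B g.
  exact: TP_col_mx_affcomb BV tpB _ ginc.
have : 0 <= (-1) ^+ e * bordered_minor (affcomb w x) B g.
  apply: le_trans (alternates_along_bordered_minor_ge ord0 _ ginc alt).
    by rewrite mulr_ge0// ltW// tpB//; apply: increasing_lift.
  exact: TP_TNN.
by case: e xe {ek alt} => // _; rewrite expr1 mulN1r oppr_ge0 leNgt minor_gt0.
Qed.

Lemma line_eq_Psi s v : Sign_bar k s -> v \in W -> v != 0 ->
  sign v = s \/ sign v = signvec_opp s ->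
  exists2 x, psi w x = s & line v = Psi w x.
Proof.
move=> sS vW v0 vs; have [_ sk _] := sS.
have vk : ovar (sign v) = k%:Z by case: vs => ->; rewrite ?ovar_opp.
have [c [x [c0 vE]]] := ovar_eq_scale_affcomb vW v0 vk.
exists x; last by rewrite vE line_scale.
have xS : Sign_bar k (psi w x).
  by apply: psi_Sign_bar; rewrite -vk vE ovar_sign_scale.
have : psi w x = s \/ psi w x = signvec_opp s.
  have -> : psi w x = sign (c^-1 *: v) by rewrite vE scalerA mulVf// scale1r.
  by case: (sign_scale v (invr_neq0 c0)) => ->; case: vs => ->;
    rewrite ?signvec_oppK; [left|right|right|left].
by case=> // xE; rewrite xE in xS; case: (Sign_bar_opp sS xS).
Qed.

Lemma image_Psi_face s : Sign_bar k s -> Psi w @` face w s = stratum W s.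
Proof.
move=> sS; apply/seteqP; split=> L.
  move=> [x xs <-]; exists (affcomb w x); rewrite affcomb_mem affcomb_neq0.
  by split=> //; [left|rewrite val_line// affcomb_neq0].
move=> [v [vW v0 vs /val_eq_line ->]].
by have [x xs ->] := line_eq_Psi sS vW v0 vs; exists x.
Qed.

Lemma psi_realize s : Sign_bar k s -> exists x, psi w x = s.
Proof.
move=> sS; have [/eqP s0 sk _] := sS.
have [|v vW vs] := Gr_pos_sign_realize hW s0; first by rewrite sk ltz_nat.
have v0 : v != 0 by rewrite -sign_eq0 vs.
by have [x xs _] := line_eq_Psi sS vW v0 (or_introl vs); exists x.
Qed.

Lemma stratum_opp s : stratum W (signvec_opp s) = stratum W s.
Proof.
by apply/seteqP; split=> L [v [vW v0 vs Lv]]; exists v; split=> //;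
  case: vs => ->; rewrite ?signvec_oppK; [right|left|right|left].
Qed.

Lemma strataP S : strata k W S <-> exists2 s, Sign_bar k s & S = stratum W s.
Proof.
split=> [[s [/eqP s0 sk ->]]|[s [s0 sk _] ->]]; last by exists s.
have [sS|sS] := Sign_bar_or_opp s0 sk; first by exists s.
by exists (signvec_opp s); rewrite ?stratum_opp.
Qed.

(* Each entry of z = affcomb w x on a weakly alternating subsequence of length
   k + 1 is bounded, up to a positive factor, by a minor that does not depend on
   x. *)
Lemma face_bounded_entries s : Sign_bar k s ->
  exists2 f : 'I_k -> 'I_n.+1, increasing f &
    exists c : R, forall x, face w s x -> `|colsub f (affcomb w x)| <= c.
Proof.
move=> sS; have [B BV tpB] := hV.
have [|g ginc gs] := @alt_length_subseq _ k.+1 false s.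
  by rewrite (Sign_bar_alt_length sS).
exists (g \o lift ord0); first exact: increasing_lift.
pose d j := \det (colsub (g \o lift (lift ord0 j)) B).
have d_gt0 j : 0 < d j by apply/tpB/increasing_lift.
pose D := bordered_minor (w ord0) B g.
have D_gt0 : 0 < D.
  by rewrite /D -(bordered_minor_affcomb _ 0 BV); apply: TP_col_mx_affcomb.
exists (\sum_j D / d j) => x xs; apply: mx_norm_le => [|i j].
  by apply: sumr_ge0 => j _; rewrite divr_ge0 ?ltW.
rewrite mxE (ord1 i) (bigD1 j)//= -[leLHS]addr0; apply: lerD; last first.
  by apply: sumr_ge0 => l _; rewrite divr_ge0 ?ltW.
have /weakly_alternates_sign alt :
    weakly_alternates false (sign (affcomb w x)) g.
  by rewrite -[sign _]/(psi w x) xs.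
rewrite ler_pdivlMr//.
apply: le_trans (alternates_along_bordered_minor_ge _ (TP_TNN tpB) ginc alt) _.
by rewrite mul1r (bordered_minor_affcomb _ _ BV).
Qed.

Lemma colsub_dirmx_unit (f : 'I_k -> 'I_n.+1) :
  increasing f -> colsub f dirmx \in unitmx.
Proof.
have [B BV tpB] := hV => finc.
have /submxP[Q BE] : (B <= dirmx)%MS.
  by apply/row_subP => i; rewrite -mem_dirspan (represents_mem _ BV) row_sub.
have := tpB f finc; rewrite BE -mulmx_colsub det_mulmx => /lt0r_neq0.
by rewrite mulf_eq0 negb_or unitmxE unitfE => /andP[].
Qed.

Lemma bounded_face s : Sign_bar k s -> bounded_set (face w s).
Proof.
move=> /face_bounded_entries[f /colsub_dirmx_unit fU [c fc]].
pose N := invmx (colsub f dirmx).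
exists (k%:R * ((c + `|colsub f (w ord0)|) * `|N|)).
split; first exact: num_real.
move=> M ltM x xs /=; apply: le_trans (ltW ltM).
have -> : x = (colsub f (affcomb w x) - colsub f (w ord0)) *m N.
  by rewrite affcombE linearD /= addrAC subrr add0r -mulmx_colsub mulmxK.
apply: le_trans (mx_norm_mulmx _ _) _; rewrite ler_wpM2l// ler_wpM2r//.
by apply: le_trans (ler_normB _ _) _; rewrite lerD2r fc.
Qed.

(* A vector of V with the signs of psi w x is a recession direction. *)
Lemma unbounded_face x :
  ovar (psi w x) < k%:Z -> ~ bounded_set (face w (psi w x)).
Proof.
move=> xk; have [v vV vx] := Gr_pos_sign_realize hV (psi_neq0 x) xk.
move: vV; rewrite mem_dirspan => /submxP[d vE].
apply: (@ray_unbounded _ _ _ x d) => [|t t0].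
  by apply: contraNneq (psi_neq0 x) => d0; rewrite -vx sign_eq0 vE d0 mul0mx.
apply/ffunP => i; have /ffunP/(_ i) := vx; rewrite !ffunE => vi.
rewrite affcombE mulmxDl addrA -affcombE -scalemxAl -vE mxE [X in _ + X]mxE.
by rewrite sgn_ofD// sgn_ofM.
Qed.

Lemma bounded_faceP x :
  bounded_set (face w (psi w x)) <-> ovar (psi w x) = k%:Z.
Proof.
split=> [bd|xk]; last exact/bounded_face/psi_Sign_bar.
have := Gr_pos_ovar_lt hW (affcomb_mem x) (affcomb_neq0 x).
rewrite -/(psi w x) => lt_k1; have : ~~ (ovar (psi w x) < k%:Z).
  by apply/negP => /unbounded_face.
by rewrite -leNgt; lia.
Qed.

Lemma bounded_facesP F :
  bounded_faces w F <-> exists2 s, Sign_bar k s & F = face w s.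
Proof.
split=> [[[s ->] [x xs] bd]|[s sS ->]].
  exists s => //; rewrite -xs; apply/psi_Sign_bar/bounded_faceP; rewrite xs.
  exact: bd.
have [x xs] := psi_realize sS.
by split; [exists s|exists x|exact: bounded_face].
Qed.

Lemma bounded_complexP x : bounded_complex w x <-> ovar (psi w x) = k%:Z.
Proof.
split=> [[_ /bounded_facesP[s [_ sk _] ->] ->]//|xk].
exists (face w (psi w x)) => //; apply/bounded_facesP.
by exists (psi w x) => //; exact: psi_Sign_bar.
Qed.

Lemma amplituhedron_sub_Psi L : amplituhedron k W L ->
  exists2 x, ovar (psi w x) = k%:Z & L = Psi w x.
Proof.
move=> [V' V'nn LV']; have LE := line_vpick L; have v0 := vpick_projsp_neq0 L.
set v := vpick _ in LE v0.
have : v \in (orthv V' :&: W)%VS by rewrite -LV' memv_pick.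
move=> /memv_capP[vV' vW].
have vk : ovar (sign v) = k%:Z.
  have := Gr_nonneg_orthv_ovar_ge hV V'nn vV' v0.
  by have := Gr_pos_ovar_lt hW vW v0; lia.
have [c [x [c0 vE]]] := ovar_eq_scale_affcomb vW v0 vk.
by exists x; [rewrite -vk vE ovar_sign_scale|rewrite -LE vE line_scale].
Qed.

Lemma Psi_sub_amplituhedron x :
  ovar (psi w x) = k%:Z -> amplituhedron k W (Psi w x).
Proof.
move=> xk; have /exists_Gr_nonneg_orthv[V' V'nn xV'] :
  k%:Z <= ovar (sign (affcomb w x)) by rewrite -/(psi w x) xk.
exists V' => //; rewrite /= /Psi val_line ?affcomb_neq0//.
apply/eqP; rewrite eqEsubv -memvE memv_cap xV' affcomb_mem /=.
apply/subvP => v /memv_capP[vV' /(exists_sub_affcomb_dirspan x)[c cV]].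
apply/vlineP; exists c; apply/eqP; rewrite -subr_eq0; apply/negP => /negP vc0.
have vcV' : v - c *: affcomb w x \in orthv V' by rewrite rpredB// rpredZ.
have := Gr_pos_ovar_lt hV cV vc0.
by rewrite ltNge (Gr_nonneg_orthv_ovar_ge hV V'nn vcV' vc0).
Qed.

Lemma amplituhedronP L : amplituhedron k W L <->
  exists2 x, bounded_complex w x & L = Psi w x.
Proof.
split=> [/amplituhedron_sub_Psi[x xk ->]|[x /bounded_complexP xk ->]].
  by exists x => //; apply/bounded_complexP.
exact: Psi_sub_amplituhedron.
Qed.

(* Dehomogenization of the coordinates in the basis w: the coordinate on w^(0)
   is scaled to 1. *)
Definition chart v : 'rV[R]_k :=
  ((v *m lsubmx (pinvmx basismx)) 0 0)^-1 *: (v *m rsubmx (pinvmx basismx)).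

Lemma mul_affcomb_pinvmx x : affcomb w x *m pinvmx basismx = row_mx 1%:M x.
Proof. by rewrite affcomb_basismx (mulmxKp basismx_free). Qed.

Lemma mul_affcomb_lsubmx x : (affcomb w x *m lsubmx (pinvmx basismx)) 0 0 = 1.
Proof. by rewrite mulmx_lsub mul_affcomb_pinvmx row_mxKl mxE. Qed.

Lemma chart_affcomb x : chart (affcomb w x) = x.
Proof.
rewrite /chart mul_affcomb_lsubmx mulmx_rsub mul_affcomb_pinvmx row_mxKr.
by rewrite invr1 scale1r.
Qed.

Lemma chart_scale (c : R) v : c != 0 -> chart (c *: v) = chart v.
Proof.
move=> c0; rewrite /chart -!scalemxAl mxE scalerA invfM.
by rewrite mulrAC mulVf// mul1r.
Qed.

Lemma chart_continuous x : {for affcomb w x, continuous chart}.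
Proof.
apply: continuousZ; last exact: mulmxr_continuous.
apply: continuousV; first by rewrite mul_affcomb_lsubmx oner_eq0.
apply: (@continuous_comp _ _ _
  (fun v => v *m lsubmx (pinvmx basismx)) (fun M => M 0 0)).
  exact: mulmxr_continuous.
exact: coord_continuous.
Qed.

Lemma affcomb_continuous : continuous (affcomb w).
Proof.
have /funext -> : affcomb w =1 fun x => w ord0 + x *m dirmx := affcombE.
move=> x; apply: (@continuousD _ _ _ (fun=> w ord0) (fun x => x *m dirmx)).
  exact: cst_continuous.
exact: mulmxr_continuous.
Qed.

Lemma Psi_continuous : continuous (Psi w).
Proof.
move=> x; apply: (@continuous_comp _ _ _ (affcomb w) (@line R n)).
  exact: affcomb_continuous.
exact/line_continuous/affcomb_neq0.
Qed.

Definition Psi_inv (L : projsp R n) : 'rV[R]_k := chart (vpick (val L)).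

Lemma PsiK : cancel (Psi w) Psi_inv.
Proof.
move=> x; rewrite -[RHS]chart_affcomb.
exact: (scale_invariant_vpick chart_scale (affcomb_neq0 x)).
Qed.

Lemma Psi_inv_continuous x : {for Psi w x, continuous Psi_inv}.
Proof.
apply: (scale_invariant_continuous chart_scale (affcomb_neq0 x)).
exact: chart_continuous.
Qed.

Lemma homeomorphism_Psi :
  homeomorphism_on (bounded_complex w) (amplituhedron k W) (Psi w).
Proof.
split.
- split=> [x Bx|x y _ _ /(can_inj PsiK)//|L].
    by apply/amplituhedronP; exists x.
  by move=> /amplituhedronP[x Bx ->]; exists x.
- by apply: continuous_in_subspaceT => x _; exact: Psi_continuous.
- exists Psi_inv; last by move=> x _; exact: PsiK.
  apply: continuous_in_subspaceT => L /set_mem/amplituhedronP[x _ ->].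
  exact: Psi_inv_continuous.
Qed.

Lemma closure_poset_iso_Psi :
  closure_poset_iso (bounded_faces w) (strata k W) (fun F => Psi w @` F).
Proof.
split=> [|F G _ _]; last first.
  exact: closure_subset_image PsiK Psi_continuous Psi_inv_continuous.
split=> [F /bounded_facesP[s sS ->]|F G _ _ /(can_inj (image_cancel PsiK))//|S].
  by apply/strataP; exists s; rewrite ?image_Psi_face.
move=> /strataP[s sS ->]; exists (face w s); last exact: image_Psi_face.
by apply/bounded_facesP; exists s.
Qed.

End Arrangement.

Theorem theorem6p14 (R : realType) (n k : nat) (hk : (k < n.+1)%N)
    (W : {vspace 'rV[R]_n.+1}) (w : 'I_k.+1 -> 'rV[R]_n.+1)
    (hW : Gr_pos k.+1 W) (hw : basis_of W (codom w))
    (hV : Gr_pos k (dirspan w))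
    (hw0 : positively_oriented (dirspan w) (w ord0)) :
  [/\ homeomorphism_on (bounded_complex w) (amplituhedron k W) (Psi w),
      closure_poset_iso (bounded_faces w) (strata k W)
        (fun F => Psi w @` F) &
      forall s : signvec n.+1, Sign_bar k s ->
        bounded_faces w (face w s) /\ Psi w @` face w s = stratum W s].
Proof.
split=> [||s sS]; [exact: homeomorphism_Psi|exact: closure_poset_iso_Psi|].
split; last exact: image_Psi_face.
by apply/(bounded_facesP hW hw hV hw0); exists s.
Qed.
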